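(* Let $A,b,\sigma$ satisfy the coefficient assumptions, $f,\Phi,\Psi$ the data assumptions, and $\{P_{t,s}\}$ the smoothing assumption (with exponent $\gamma\in(0,1)$) of the context, and let the obstacle $\Phi$ be admissible. For $\varepsilon>0$ let $u_\varepsilon$ be the unique mild solution of the penalized equation, and let $V$ be the pointwise limit of $u_\varepsilon$ as $\varepsilon\downarrow0$. Then for any fixed $t\in[0,T)$ there is a map $g(t,\cdot):H\to H$ such that: (i) for every $x\in H$, the family of Fréchet gradients $\{\nabla u_\varepsilon(t,x)\}_{\varepsilon>0}$ admits a subsequence converging weakly in $H$ to $g(t,x)$ as $\varepsilon\to0$; (ii) for any $\beta\in(0,1)$ with $\gamma(1+\beta)<1$, the map $g(t,\cdot)$ is locally $\beta$-Hölder continuous on $H$; (iii) the map $V(t,\cdot)$ is Fréchet differentiable on $H$ and its gradient is $\nabla V(t,\cdot)=g(t,\cdot)$; hence $V(t,\cdot)\in\mathcal C^{1,\beta}_{loc}(H)$ for every such $\beta$.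
   Context: Setting. $T>0$ is a fixed horizon; $H$ and $\Xi$ are real separable Hilbert spaces with their Borel $\sigma$-algebras; $\mathcal L_2(\Xi,H)$ is the space of Hilbert–Schmidt operators. $(\Omega,\mathcal F,\mathbb F=\{\mathcal F_s\}_{s\ge0},\mathbb P)$ is a filtered probability space satisfying the usual conditions, and $W$ is a cylindrical $\mathbb F$-Wiener process on $\Xi$. Weighted spaces. Fix $m\ge1$ and set $w_m(x):=1+\|x\|_H^m$. $\mathcal B_m(H)$ is the space of Borel maps $\varphi:H\to\mathbb R$ with $\|\varphi\|_{\mathcal B_m}:=\sup_x|\varphi(x)|/w_m(x)<\infty$; $\mathcal B_m([0,T]\times H)$ is the space of Borel maps $\psi:[0,T]\times H\to\mathbb R$ with $\|\psi\|_{\mathcal B_{m,T}}:=\sup_{(t,x)}|\psi(t,x)|/w_m(x)<\infty$. $\mathcal C_m(H)$ and $\mathcal C_m([0,T]\times H)$ are the subspaces of (jointly) continuous maps. $\mathrm{Lip}_m(H)$ is the set of $\varphi\in\mathcal C_m(H)$ such that for some $K>0$, $|\varphi(x)-\varphi(y)|\le K(1+\|x\|_H^{m-1}+\|y\|_H^{m-1})\|x-y\|_H$ for all $x,y\in H$; $\mathrm{Lip}_m([0,T]\times H)$ is the set of $\psi\in\mathcal C_m([0,T]\times H)$ satisfying this estimate for $\psi(t,\cdot)$ with $K$ independent of $t\in[0,T]$. Coefficient assumptions. $A:\mathrm{Dom}(A)\subset H\to H$ is closed, densely defined and generates a $C_0$-semigroup $\{e^{\tau A}\}_{\tau\ge0}$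 on $H$; $b:[0,T]\times H\to H$ and $\sigma:[0,T]\times H\to\mathcal L_2(\Xi,H)$ are Borel measurable, and there are constants $L,K>0$ with $\|b(s,x)-b(s,y)\|_H+\|\sigma(s,x)-\sigma(s,y)\|_{\mathcal L_2}\le L\|x-y\|_H$ and $\|b(s,x)\|_H+\|\sigma(s,x)\|_{\mathcal L_2}\le K(1+\|x\|_H)$ for all $s\in[0,T]$, $x,y\in H$. State process. $X(\cdot;t,x)$ is the unique continuous mild solution on $[t,T]$ of $\mathrm dX(s)=[AX(s)+b(s,X(s))]\mathrm ds+\sigma(s,X(s))\mathrm dW(s)$, $X(t)=x$, i.e. $X(s)=e^{(s-t)A}x+\int_t^se^{(s-r)A}b(r,X(r))\mathrm dr+\int_t^se^{(s-r)A}\sigma(r,X(r))\mathrm dW(r)$. For $\varphi\in\mathcal B_m(H)$ and $0\le t\le s\le T$, $P_{t,s}[\varphi](x):=\mathbb E[\varphi(X(s;t,x))]$. Smoothing assumption. For all $0\le t<s\le T$ and $\varphi\in\mathcal B_m(H)$, the map $x\mapsto P_{t,s}[\varphi](x)$ is twice continuously Fréchet differentiable on $H$, and there are constants $C_1>0$ and $\gamma\in(0,1)$ such that for all such $t,s,\varphi$ and all $x\in H$: $\|\nabla P_{t,s}[\varphi](x)\|_H\le C_1(s-t)^{-\gamma}w_m(x)\|\varphi\|_{\mathcal B_m}$ and $\|\nabla^2P_{t,s}[\varphi](x)\|_{\mathcal L(H)}\le C_1(s-t)^{-2\gamma}w_m(x)\|\varphi\|_{\mathcal B_m}$. Data assumptions.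 $f,\Phi\in\mathrm{Lip}_m([0,T]\times H)$, $\Psi\in\mathrm{Lip}_m(H)$, and $\Psi(x)\le\Phi(T,x)$ for all $x\in H$. Penalized equation. For $\varepsilon>0$, the mild solution $u_\varepsilon$ of the penalized equation is the unique $u_\varepsilon\in\mathcal B_m([0,T]\times H)$ (it exists, is unique, and lies in $\mathcal C_m([0,T]\times H)$) such that for all $(t,x)\in[0,T]\times H$ $$u_\varepsilon(t,x)=P_{t,T}[\Psi](x)+\int_t^TP_{t,s}\Big[f(s,\cdot)-\tfrac1\varepsilon\big(u_\varepsilon(s,\cdot)-\Phi(s,\cdot)\big)^+\Big](x)\,\mathrm ds.$$ The pointwise limit $\lim_{\varepsilon\downarrow0}u_\varepsilon(t,x)$ exists for every $(t,x)\in[0,T]\times H$, and under the smoothing assumption $u_\varepsilon(t,\cdot)$ is continuously Fréchet differentiable for every $t\in[0,T)$. Admissible obstacle. $\Phi$ is admissible if there is $K>0$, independent of $\varepsilon$, with $\sup_{\varepsilon>0}\|\Pi_\varepsilon\|_{\mathcal B_{m,T}}\le K$, where $\Pi_\varepsilon:=\frac1\varepsilon(u_\varepsilon-\Phi)^+$. Local Hölder continuity. A map on $H$ is locally $\beta$-Hölder continuous if it is $\beta$-Hölder continuous on every closed ball $B_R=\{x:\|x\|_H\le R\}$; $\mathcal C^{1,\beta}_{loc}(H)$ is the set of continuously Fréchet differentiable functions $H\to\mathbb R$ whose gradient is locally $\beta$-Hölder continuous. *)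

(* Defs.v *)
From HB Require Import structures.
From Stdlib Require List.
From mathcomp Require Import all_boot all_order all_algebra.
From mathcomp Require Import all_classical all_reals all_analysis.

Set Implicit Arguments.
Unset Strict Implicit.
Unset Printing Implicit Defensive.

Import Order.TTheory GRing.Theory Num.Theory.
Import numFieldNormedType.Exports.

Local Open Scope classical_set_scope.
Local Open Scope ring_scope.

HB.mixin Record CompleteNormedModule_isHilbert (R : realType) H
    & CompleteNormedModule R H := {
  inner : H -> H -> R ;
  innerC : forall x y, inner x y = inner y x ;
  innerDl : forall x y z, inner (x + y) z = inner x z + inner y z ;
  innerZl : forall (a : R) x y, inner (a *: x) y = a * inner x y ;
  inner_normE : forall x, inner x x = `|x| ^+ 2 }.

#[short(type="hilbertType")]
HB.structure Definition Hilbert (R : realType) :=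
  {H of CompleteNormedModule R H & CompleteNormedModule_isHilbert R H}.

Notation "'<|' x , y '|>'" := (inner x y) (at level 0, x, y at level 99,
  format "'<|' x ,  y '|>'") : ring_scope.

Notation borel T := (g_sigma_algebraType (@open T)).

Definition separable (T : topologicalType) : Prop :=
  exists D : set T, countable D /\ dense D.

Section Gradient.
Context {R : realType} {H : hilbertType R}.

(* The Riesz representative of the Fréchet differential; it is meaningful only
   at points of differentiability. *)
Definition grad (f : H -> R) (x : H) : H :=
  xget 0 [set p : H | forall h, 'd f x h = <| p, h |>].

Definition op_norm (L : H -> H) : R :=
  sup [set `|L h| | h in [set h : H | `|h| <= 1]].

Definition twice_continuously_differentiable (f : H -> R) : Prop :=
  [/\ forall x, differentiable f x,
      forall x, differentiable (grad f) x &
      forall x (e : R), 0 < e ->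
        \forall y \near x, op_norm ('d (grad f) y \- 'd (grad f) x) < e].

Definition locally_holder (beta : R) (g : H -> H) : Prop :=
  forall r : R, 0 < r -> exists C : R, forall x y : H,
    `|x| <= r -> `|y| <= r -> `|g x - g y| <= C * `|x - y| `^ beta.

Definition C1_loc (beta : R) (f : H -> R) : Prop :=
  [/\ forall x, differentiable f x,
      continuous (grad f) &
      locally_holder beta (grad f)].

Definition weakly_converges (p : nat -> H) (q : H) : Prop :=
  forall h : H, (fun n => <| p n, h |>) @ \oo --> <| q, h |>.

End Gradient.

Section Weighted.
Context {R : realType} {H : hilbertType R}.

Definition weight (m : R) (x : H) : R := 1 + `|x| `^ m.

(* The norms are extended-real, so that no value is assigned by convention to
   functions of faster growth. *)
Definition Bnorm (m : R) (phi : H -> R) : \bar R :=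
  ereal_sup [set (`|phi x| / weight m x)%:E | x in [set: H]].

Definition BnormT (T m : R) (psi : R -> H -> R) : \bar R :=
  ereal_sup [set (`|psi p.1 p.2| / weight m p.2)%:E
            | p in `[0, T] `*` [set: H]].

Definition in_B (m : R) (phi : H -> R) : Prop :=
  measurable_fun [set: borel H] phi /\ (Bnorm m phi < +oo)%E.

(* A map on [0,T] x H is a curried function on R x H of which only the values
   on [0,T] x H matter. *)
Definition in_BT (T m : R) (psi : R -> H -> R) : Prop :=
  measurable_fun (`[0, T] `*` [set: H] : set (borel (R * H)%type))
    (fun p => psi p.1 p.2) /\
  (BnormT T m psi < +oo)%E.

Definition in_C (m : R) (phi : H -> R) : Prop :=
  in_B m phi /\ continuous phi.

Definition in_CT (T m : R) (psi : R -> H -> R) : Prop :=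
  in_BT T m psi /\
  {within `[0, T] `*` [set: H], continuous (fun p : R * H => psi p.1 p.2)}.

Definition lip_estimate (m K : R) (phi : H -> R) : Prop :=
  forall x y : H, `|phi x - phi y|
    <= K * (1 + `|x| `^ (m - 1) + `|y| `^ (m - 1)) * `|x - y|.

Definition in_Lip (m : R) (phi : H -> R) : Prop :=
  in_C m phi /\ exists2 K : R, 0 < K & lip_estimate m K phi.

Definition in_LipT (T m : R) (psi : R -> H -> R) : Prop :=
  in_CT T m psi /\ exists2 K : R, 0 < K &
    forall t, 0 <= t <= T -> lip_estimate m K (psi t).

End Weighted.

Section HilbertSchmidt.
Context {R : realType} {Xi H : hilbertType R}.

Definition orthonormal_basis (E : set Xi) : Prop :=
  [/\ forall e, E e -> `|e| = 1,
      forall e e', E e -> E e' -> e <> e' -> <| e, e' |> = 0 &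
      forall x, (forall e, E e -> <| e, x |> = 0) -> x = 0].

(* The Hilbert-Schmidt norm does not depend on the basis, so one is chosen. *)
Definition hs_basis : set Xi := xget set0 orthonormal_basis.

Definition hs_sq (G : Xi -> H) : \bar R :=
  (\esum_(e in hs_basis) (`|G e| ^+ 2)%:E)%E.

Definition hs_norm (G : Xi -> H) : R := Num.sqrt (fine (hs_sq G)).

Definition hilbert_schmidt (G : Xi -> H) : Prop :=
  [/\ linear G, continuous G & (hs_sq G < +oo)%E].

(* Open sets of the Hilbert space of Hilbert-Schmidt operators. *)
Definition hs_open (U : set (Xi -> H)) : Prop :=
  U `<=` hilbert_schmidt /\
  forall G, U G -> exists2 r : R, 0 < r &
    forall G', hilbert_schmidt G' -> hs_norm (G' \- G) < r -> U G'.

Definition hs_measurable d (S : measurableType d) (D : set S)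
    (G : S -> Xi -> H) : Prop :=
  (forall z, D z -> hilbert_schmidt (G z)) /\
  forall U, hs_open U -> measurable (D `&` G @^-1` U).

End HilbertSchmidt.

Section Semigroup.
Context {R : realType} {H : hilbertType R}.

Record C0_semigroup (S : R -> H -> H) : Prop := {
  sg_linear : forall s, 0 <= s -> linear (S s) ;
  sg_continuous : forall s, 0 <= s -> continuous (S s) ;
  sg_0 : forall x, S 0 x = x ;
  sg_D : forall r s x, 0 <= r -> 0 <= s -> S (r + s) x = S r (S s x) ;
  sg_strong : forall x, S ^~ x @ 0^'+ --> x }.

(* A is an operator with domain domA; its values outside domA are irrelevant. *)
Record generates (domA : set H) (A : H -> H) (S : R -> H -> H) : Prop := {
  gen_domain : dense domA ;
  gen_linear : forall (a : R) x y, domA x -> domA y ->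
    domA (a *: x + y) /\ A (a *: x + y) = a *: A x + A y ;
  gen_closed : closed [set p : H * H | domA p.1 /\ p.2 = A p.1] ;
  gen_semigroup : C0_semigroup S ;
  gen_derivative : forall x y, (domA x /\ A x = y) <->
    (fun h : R => h^-1 *: (S h x - x)) @ 0^'+ --> y }.

End Semigroup.

Record coefficient_assumptions (R : realType) (Xi H : hilbertType R) (T : R)
    (domA : set H) (A : H -> H) (S : R -> H -> H)
    (b : R -> H -> H) (sigma : R -> H -> Xi -> H) : Prop := {
  coeff_generates : generates domA A S ;
  coeff_b_measurable :
    measurable_fun (`[0, T] `*` [set: H] : set (borel (R * H)%type))
      ((fun p => b p.1 p.2) : borel (R * H)%type -> borel H) ;
  coeff_sigma_measurable :
    hs_measurable (`[0, T] `*` [set: H] : set (borel (R * H)%type))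
      (fun p => sigma p.1 p.2) ;
  coeff_lipschitz : exists2 L : R, 0 < L & forall s x y, 0 <= s <= T ->
    `|b s x - b s y| + hs_norm (sigma s x \- sigma s y) <= L * `|x - y| ;
  coeff_growth : exists2 K : R, 0 < K & forall s x, 0 <= s <= T ->
    `|b s x| + hs_norm (sigma s x) <= K * (1 + `|x|) }.

Section Bochner.
Context {R : realType} {H : hilbertType R}.

Definition simple_fun (l : seq (set R * H)) (r : R) : H :=
  \sum_(c <- l) \1_(c.1) r *: c.2.

Definition simple_integral (D : set R) (l : seq (set R * H)) : H :=
  \sum_(c <- l) fine (lebesgue_measure (D `&` c.1)) *: c.2.

(* D is meant to have finite Lebesgue measure. *)
Definition bochner_integral (D : set R) (f : R -> H) (I : H) : Prop :=
  measurable_fun D (f : R -> borel H) /\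
  exists l : nat -> seq (set R * H),
    [/\ forall n c, List.In c (l n) -> measurable c.1,
        (\int[lebesgue_measure]_(r in D) `|f r - simple_fun (l n) r|%:E)%E
          @[n --> \oo] --> 0%E &
        simple_integral D (l n) @[n --> \oo] --> I].

End Bochner.

Section Stochastic.
Context {R : realType} {d : measure_display} {Omega : measurableType d}.
Context (P : probability Omega R) (F : R -> set (set Omega)).

Record usual_conditions : Prop := {
  filt_sigma : forall s, 0 <= s -> sigma_algebra [set: Omega] (F s) ;
  filt_sub : forall s, 0 <= s -> F s `<=` measurable ;
  filt_mono : forall r s, 0 <= r -> r <= s -> F r `<=` F s ;
  filt_right : forall s, 0 <= s -> \bigcap_(r in `]s, +oo[) F r `<=` F s ;
  filt_null : P.-negligible `<=` F 0 }.

Context {Xi H : hilbertType R}.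

Definition increment (W : R -> Xi -> Omega -> R) (r s : R) (h : Xi)
    (w : Omega) : R :=
  W s h w - W r h w.

(* W s h is the real random variable W(s)h; the covariance
   E[W(s)h W(r)k] = min(s,r) <h,k> follows from linearity and polarization. *)
Record cylindrical_wiener (W : R -> Xi -> Omega -> R) : Prop := {
  cw_linear : forall (s a : R) h k, 0 <= s ->
    {ae P, forall w, W s (a *: h + k) w = a * W s h w + W s k w} ;
  cw_0 : forall h, {ae P, forall w, W 0 h w = 0} ;
  cw_continuous : forall h,
    {ae P, forall w, {within `[0, +oo[, continuous (fun s : R => W s h w)}} ;
  cw_adapted : forall (s : R) h (B : set R), 0 <= s -> measurable B ->
    F s (W s h @^-1` B) ;
  cw_independent : forall (r s : R) h (A : set Omega) (B : set R),
    0 <= r -> r <= s -> F r A -> measurable B ->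
    P (A `&` (increment W r s h @^-1` B)) =
    (P A * P (increment W r s h @^-1` B))%E ;
  cw_gaussian : forall (r s : R) h (B : set R),
    0 <= r -> r < s -> h != 0 -> measurable B ->
    P (increment W r s h @^-1` B) =
    normal_prob 0 (Num.sqrt (s - r) * `|h|) B }.

(* The elementary process  1_{]el_lo, el_hi]} 1_{el_event} (el_in (x) el_out). *)
Record elementary := Elementary {
  el_lo : R ; el_hi : R ; el_event : set Omega ; el_in : Xi ; el_out : H }.

Definition elementary_process (l : seq elementary) (r : R) (w : Omega)
    (h : Xi) : H :=
  \sum_(e <- l) (\1_(`]el_lo e, el_hi e]) r * \1_(el_event e) w
                 * <| el_in e, h |>) *: el_out e.

Definition elementary_integral (W : R -> Xi -> Omega -> R)
    (l : seq elementary) (w : Omega) : H :=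
  \sum_(e <- l) (\1_(el_event e) w
                 * (W (el_hi e) (el_in e) w - W (el_lo e) (el_in e) w))
                *: el_out e.

(* Z is the Itô integral of G over [t, s]: elementary processes approximate G in
   probability in L^2(t, s; L_2(Xi, H)), and their integrals converge to Z in
   probability. *)
Definition stochastic_integral (W : R -> Xi -> Omega -> R) (t s : R)
    (G : R -> Omega -> Xi -> H) (Z : Omega -> H) : Prop :=
  [/\ forall r w, t <= r <= s -> hilbert_schmidt (G r w),
      forall h, measurable_fun (`[t, s] `*` [set: Omega])
        ((fun p => G p.1 p.2 h) : R * Omega -> borel H),
      measurable_fun [set: Omega] (Z : Omega -> borel H) &
      exists l : nat -> seq elementary,
      [/\ forall n e, List.In e (l n) ->
            [/\ t <= el_lo e, el_lo e <= el_hi e, el_hi e <= s &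
                F (el_lo e) (el_event e)],
          forall e : R, 0 < e ->
            P [set w | (e%:E <= \int[lebesgue_measure]_(r in `[t, s])
                 hs_sq (G r w \- elementary_process (l n) r w)%R)%E]
            @[n --> \oo] --> 0%E &
          forall e : R, 0 < e ->
            P [set w | (e <= `|Z w - elementary_integral W (l n) w|)%R]
            @[n --> \oo] --> 0%E]].

(* Continuous mild solution on [t, T] started from x at time t; the semigroup
   is S s = e^{sA}. *)
Record mild_solution (W : R -> Xi -> Omega -> R) (T : R) (S : R -> H -> H)
    (b : R -> H -> H) (sigma : R -> H -> Xi -> H) (t : R) (x : H)
    (X : R -> Omega -> H) : Prop := {
  mild_adapted : forall s (B : set (borel H)), t <= s <= T -> measurable B ->
    F s (X s @^-1` B) ;
  mild_continuous : forall w, {within `[t, T], continuous (fun s : R => X s w)} ;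
  mild_equation : forall s, t <= s <= T -> exists2 Z : Omega -> H,
    stochastic_integral W t s
      (fun r w => S (s - r) \o sigma r (X r w)) Z &
    {ae P, forall w, exists2 I : H,
      bochner_integral `[t, s] (fun r => S (s - r) (b r (X r w))) I &
      X s w = S (s - t) x + I + Z w} }.

(* X t x s is the state X(s; t, x). *)
Definition transition (X : R -> H -> R -> Omega -> H) (t s : R)
    (phi : H -> R) (x : H) : R :=
  fine 'E_P[fun w => phi (X t x s w)].

Definition smoothing_assumption (T m gamma : R)
    (X : R -> H -> R -> Omega -> H) : Prop :=
  (forall t s phi, 0 <= t -> t < s -> s <= T -> in_B m phi ->
     twice_continuously_differentiable (transition X t s phi)) /\
  exists2 C1 : R, 0 < C1 &
    forall t s phi x, 0 <= t -> t < s -> s <= T -> in_B m phi ->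
      (`|grad (transition X t s phi) x|%:E
         <= (C1 * (s - t) `^ (- gamma) * weight m x)%:E * Bnorm m phi)%E /\
      ((op_norm ('d (grad (transition X t s phi)) x))%:E
         <= (C1 * (s - t) `^ (- (2 * gamma)) * weight m x)%:E * Bnorm m phi)%E.

Definition penalization (Phi : R -> H -> R) (eps : R) (v : R -> H -> R)
    (s : R) (x : H) : R :=
  eps^-1 * Num.max (v s x - Phi s x) 0.

(* The time integral is required to exist as a Lebesgue integral. *)
Definition penalized_solution (T m : R) (X : R -> H -> R -> Omega -> H)
    (f Phi : R -> H -> R) (Psi : H -> R) (eps : R) (v : R -> H -> R) : Prop :=
  in_BT T m v /\
  forall t x, 0 <= t <= T ->
    let integrand s :=
      transition X t s (fun y => f s y - penalization Phi eps v s y) x in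
    lebesgue_measure.-integrable `[t, T] (EFin \o integrand) /\
    v t x = transition X t T Psi x
            + \int[lebesgue_measure]_(s in `[t, T]) integrand s.

End Stochastic.

Definition data_assumptions (R : realType) (H : hilbertType R) (T m : R)
    (f Phi : R -> H -> R) (Psi : H -> R) : Prop :=
  [/\ in_LipT T m f, in_LipT T m Phi, in_Lip m Psi &
      forall x, Psi x <= Phi T x].

(* u eps is the solution of the equation with penalization parameter eps. *)
Definition admissible (R : realType) (H : hilbertType R) (T m : R)
    (Phi : R -> H -> R) (u : R -> R -> H -> R) : Prop :=
  exists2 K : R, 0 < K &
    (ereal_sup [set BnormT T m (penalization Phi eps (u eps))
               | eps in [set eps : R | (0 < eps)%R]] <= K%:E)%E.

(* Main.v *)
From HB Require Import structures.
Require Import Defs.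
From mathcomp Require Import all_boot all_order all_algebra.
From mathcomp Require Import ring lra.
From mathcomp Require Import all_classical all_reals all_analysis.
From mathcomp Require Import measurable_realfun.
Import Order.TTheory GRing.Theory Num.Theory.
Import numFieldNormedType.Exports.

Local Open Scope classical_set_scope.
Local Open Scope ring_scope.

(** Write [G_s = P_{t,s}[f(s,.) - Pi_eps(s,.)]], so that
    [u_eps(t,.) = P_{t,T}[Psi] + \int_t^T G_s ds].  Admissibility bounds the
    sources in the weighted norm by a constant independent of [eps], so on a
    ball the smoothing property bounds the gradient of [G_s] by
    [M (s-t)^{-gamma}] and its Hessian by [M (s-t)^{-2 gamma}], uniformly in
    [eps].  Interpolating between the two with weights [1 - beta] and [beta]
    gives a [beta]-Hölder constant of order [(s-t)^{-gamma (1+beta)}] for the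
    gradient of [G_s], which is integrable at [s = t] exactly when
    [gamma (1+beta) < 1].

    To integrate this in [s] and let [eps] tend to 0 without differentiating
    under the integral sign, [C^{1,beta}] regularity is expressed by
    inequalities between values of the function ([C1_modulus]):
    [|F(x+k) - F(x)| <= C |k|] and
    [|F(x+h+k) - F(x+h) - F(x+k) + F(x)| <= C |k| |h|^beta] on balls.  Such
    inequalities follow from the two derivative bounds by the mean value
    theorem ([C2_modulus]), are preserved by time integrals
    ([integral_modulus]) and by pointwise limits ([modulus_limit]), and hold
    for all [u_eps(t,.)] with the same constants ([penalized_modulus]), hence
    for [V(t,.)].

    Conversely they imply [C^{1,beta}] regularity.  The second inequality
    with [h = k] makes the dyadic difference quotients
    [2^n (F(x + 2^{-n} h) - F(x))] Cauchy with a geometric rate; their limit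
    is additive and bounded in [h], hence of the form [<p, h>] by Riesz's
    theorem, and the rate at [n = 0] says that [F] is differentiable at [x]
    with gradient [p] ([modulus_differentiable]); the second inequality with
    general [h] is the Hölder bound on the gradient ([modulus_grad_holder]).
    Since the rate depends on the constants only, pointwise convergence of
    [u_eps(t,.)] to [V(t,.)] upgrades to weak convergence of the gradients
    ([modulus_grad_weak_cvg]).  So [g] is the gradient of [V(t,.)], and
    gradients converge weakly along every sequence of positive [eps] tending
    to 0; the sequence [1/(n+1)] is used below. *)

(** * Inner products and the Riesz representation *)

Section InnerProduct.
Context {R : realType} {H : hilbertType R}.
Implicit Types x y z h : H.

Lemma innerDr x y z : <| x, y + z |> = <| x, y |> + <| x, z |>.
Proof. by rewrite innerC innerDl !(innerC _ x). Qed.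

Lemma innerZr (a : R) x y : <| x, a *: y |> = a * <| x, y |>.
Proof. by rewrite innerC innerZl innerC. Qed.

Lemma innerNl x y : <| - x, y |> = - <| x, y |>.
Proof. by rewrite -scaleN1r innerZl mulN1r. Qed.

Lemma innerNr x y : <| x, - y |> = - <| x, y |>.
Proof. by rewrite innerC innerNl innerC. Qed.

Lemma innerBl x y z : <| x - y, z |> = <| x, z |> - <| y, z |>.
Proof. by rewrite innerDl innerNl. Qed.

Lemma inner0l x : <| 0, x |> = 0.
Proof. by rewrite -(scale0r 0) innerZl mul0r. Qed.

Lemma inner0r x : <| x, 0 |> = 0.
Proof. by rewrite innerC inner0l. Qed.

Lemma normD_sqr x y : `|x + y| ^+ 2 = `|x| ^+ 2 + 2 * <| x, y |> + `|y| ^+ 2.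
Proof.
by rewrite -!inner_normE innerDl !innerDr (innerC y x); ring.
Qed.

Lemma normB_sqr x y : `|x - y| ^+ 2 = `|x| ^+ 2 - 2 * <| x, y |> + `|y| ^+ 2.
Proof. by rewrite normD_sqr normrN innerNr mulrN. Qed.

Lemma inner_eq0 x : <| x, x |> = 0 -> x = 0.
Proof. by rewrite inner_normE => /eqP; rewrite sqrf_eq0 normr_eq0 => /eqP. Qed.

Lemma inner_ext x y : (forall h, <| x, h |> = <| y, h |>) -> x = y.
Proof.
move=> xy; apply/subr0_eq/inner_eq0.
by rewrite innerBl xy subrr.
Qed.

Lemma cauchy_schwarz x y : `|<| x, y |>| <= `|x| * `|y|.
Proof.
wlog xy0 : x / 0 <= <| x, y |>.
  move=> wlg; have [/wlg//|xy0] := leP 0 <| x, y |>.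
  by have := wlg (- x); rewrite innerNl normrN normrN; apply; lra.
rewrite ger0_norm//.
have [->|x0] := eqVneq x 0; first by rewrite inner0l normr0 mul0r.
have [->|y0] := eqVneq y 0; first by rewrite inner0r normr0 mulr0.
have ab : 0 < `|x| * `|y| by rewrite mulr_gt0// normr_gt0.
have := sqr_ge0 `|(`|y| *: x - `|x| *: y)|.
rewrite normB_sqr !normrZ !normr_id innerZl innerZr => h.
rewrite -(ler_pM2l ab); nra.
Qed.

Lemma inner_continuous y : continuous (fun x => <| x, y |>).
Proof.
move=> x; apply/cvgrPdist_le => e e0.
have ey : 0 < e / (1 + `|y|) by rewrite divr_gt0// ltr_pwDl.
near=> z; rewrite -innerBl (le_trans (cauchy_schwarz _ _))//.
apply: (@le_trans _ _ (`|x - z| * (1 + `|y|))).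
  by rewrite ler_wpM2l// lerDr.
rewrite -ler_pdivlMr ?ltr_pwDl//.
Unshelve. all: by end_near. Qed.

(** The functional [J h = |h|^2 / 2 - L h] is bounded below, and the
    parallelogram law makes its minimizing sequences Cauchy.  Comparing [J] at
    the terms of such a sequence and at their translates by [h] shows in the
    limit that [L h - |h|^2 / 2 <= <p, h>]; replacing [h] by [h / n] removes
    the quadratic term, and [- h] gives the reverse inequality.  Only midpoints
    and integer fractions of vectors occur, so additivity of [L] is enough; the
    limits of difference quotients to which this is applied are directly seen
    to be additive, but not to be homogeneous. *)
Lemma riesz (L : H -> R) (M : R) :
  (forall x y, L (x + y) = L x + L y) -> (forall x, `|L x| <= M * `|x|) ->
  exists p, forall h, L h = <| p, h |>.
Proof.
move=> LD LM.
have LMn x n : L (x *+ n) = L x *+ n.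
  elim: n => [|n IH]; last by rewrite !mulrS LD IH.
  by have := LD 0 0; rewrite addr0 !mulr0n; lra.
pose J (h : H) : R := `|h| ^+ 2 / 2 - L h.
have Jge h : - (M ^+ 2 / 2) <= J h.
  have := LM h; rewrite ler_norml => /andP[_ Lh].
  by have := sqr_ge0 (`|h| - M); rewrite /J; nra.
have iJ : has_inf (range J).
  by split; [exists (J 0), 0 | exists (- (M ^+ 2 / 2)) => _ [h _ <-]].
pose i := inf (range J).
have Ji h : i <= J h by apply: ge_inf; [exact: (proj2 iJ)|exists h].
have Jinf (e : R) : 0 < e -> exists h, J h < i + e.
  by move=> e0; have [_ [h _ <-] ?] := inf_adherent e0 iJ; exists h.
have /choice[p Jp] : forall n, exists h, J h < i + n.+1%:R^-1.
  by move=> n; apply: Jinf; rewrite invr_gt0.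
have half x : 2^-1 *: x + 2^-1 *: x = x.
  by rewrite -scalerDl (_ : 2^-1 + 2^-1 = 1) ?scale1r//; lra.
have strong x y : `|x - y| ^+ 2 <= 4 * (J x + J y - 2 * i).
  have := Ji (2^-1 *: (x + y)).
  rewrite /J normrZ exprMn (normD_sqr x y) (normB_sqr x y).
  have := LD (2^-1 *: (x + y)) (2^-1 *: (x + y)); rewrite half LD.
  rewrite ger0_norm ?invr_ge0//; lra.
have pC : cvgn p.
  apply/cauchy_cvgP/cauchyP => e e0.
  have e8 : 0 < e ^+ 2 / 8 by rewrite divr_gt0// exprn_gt0.
  have [N _ HN] := near_infty_natSinv_lt (PosNum e8).
  exists (p N), N => // n /= Nn.
  rewrite -ball_normE /= -(ltr_pXn2r (n:=2)) ?nnegrE ?(ltW e0)//.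
  have := strong (p N) (p n); have := Jp N; have := Jp n.
  have := HN N (leqnn _); have := HN n Nn; rewrite /=.
  clearbody i; move: (n.+1%:R^-1) (N.+1%:R^-1) (e ^+ 2).
  move: (J (p n)) (J (p N)) (`|p N - p n| ^+ 2) => u v w a b c.
  lra.
exists (limn p) => h; set q := limn p.
have pq : p n @[n --> \oo] --> q by [].
have ge h' : L h' - `|h'| ^+ 2 / 2 <= <| q, h' |>.
  have c : <| p n, h' |> + n.+1%:R^-1 @[n --> \oo] --> <| q, h' |> + 0.
    apply: cvgD; last exact: cvg_harmonic.
    exact: (cvg_comp _ _ pq (inner_continuous h' q)).
  rewrite addr0 in c.
  rewrite -(cvg_lim _ c)//; apply: limr_ge; first by apply/cvg_ex; exists <| q, h' |>.
  near=> n; have := Ji (p n + h'); have := Jp n.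
  rewrite /J normD_sqr LD; clearbody i.
  move: (n.+1%:R^-1) (`|p n| ^+ 2) (`|h'| ^+ 2) (L (p n)) (L h') <| p n, h' |>.
  by move=> a b1 c1 u v w; lra.
have ge2 h' : L h' <= <| q, h' |>.
  have c : <| q, h' |> + `|h'| ^+ 2 / 2 * n.+1%:R^-1 @[n --> \oo]
      --> <| q, h' |> + `|h'| ^+ 2 / 2 * 0.
    by apply: cvgD; [exact: cvg_cst|apply: cvgMr; exact: cvg_harmonic].
  rewrite mulr0 addr0 in c.
  rewrite -(cvg_lim _ c)//; apply: limr_ge.
    by apply/cvg_ex; exists <| q, h' |>.
  near=> n; have n0 : (0 : R) < n.+1%:R by [].
  have La : L h' = n.+1%:R * L (n.+1%:R^-1 *: h').
    by rewrite mulr_natl -LMn -scaler_nat scalerA divff ?scale1r// gt_eqF.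
  have := ge (n.+1%:R^-1 *: h').
  rewrite normrZ exprMn innerZr La ger0_norm ?invr_ge0//.
  set a := L _; move: (`|h'| ^+ 2) <| q, h' |> => z k le1.
  set v : R := n.+1%:R in n0 le1 *.
  have -> : k + z / 2 / v = v * (v^-1 * k + v^-1 ^+ 2 * z / 2).
    by field; rewrite gt_eqF.
  by rewrite ler_pM2l// -lerBlDr.
apply/eqP; rewrite eq_le ge2/=.
have := ge2 (- h); have := LD h (- h); rewrite subrr innerNr.
by have := LMn 0 0; rewrite !mulr0n; lra.
Unshelve. all: by end_near. Qed.

End InnerProduct.

(** * Gradients and mean values *)

Section Gradient.
Context {R : realType} {H : hilbertType R}.
Implicit Types (x h k : H) (f : H -> R) (g : H -> H).

Lemma inner_is_linear x : linear (inner x : H -> R).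
Proof. by move=> a y z; rewrite innerDr innerZr. Qed.

HB.instance Definition _ x :=
  GRing.isLinear.Build R H R *:%R (inner x) (inner_is_linear x).

Lemma innerr_continuous x : continuous (inner x : H -> R).
Proof.
move=> y; rewrite (_ : inner x = (fun z => <| z, x |>)); first exact: inner_continuous.
by apply/funext => z; rewrite innerC.
Qed.

Lemma diff_bounded (W : normedModType R) (f : H -> W) x : differentiable f x ->
  exists2 M, 0 < M & forall h, `|'d f x h| <= M * `|h|.
Proof.
move=> df; have /linear_boundedP : bounded_near ('d f x) (nbhs (0 : H)).
  exact/(@continuous_linear_bounded _ _ _ 0)/diff_continuous.
move=> [M [_ fM]]; exists (`|M| + 1) => [|h]; first by rewrite ltr_wpDl.
by apply: fM; rewrite (le_lt_trans (ler_norm M))// ltrDl.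
Qed.

(** By Riesz's theorem the set from which [grad] selects is inhabited at a
    point of differentiability. *)
Lemma diff_grad f x : differentiable f x ->
  forall h, 'd f x h = <| grad f x, h |>.
Proof.
move=> /diff_bounded[M _ fM].
have [p fp] := riesz _ _ (linearD ('d f x)) fM.
exact: (@xgetPex _ 0 [set q | forall h, 'd f x h = <| q, h |>] (ex_intro _ p fp)).
Qed.

Lemma op_norm_ubound g x : differentiable g x ->
  has_ubound [set `|'d g x h| | h in [set h : H | `|h| <= 1]].
Proof.
move=> /diff_bounded[M M0 gM]; exists M => _ [y /= y1 <-].
by rewrite (le_trans (gM y))// ger_pMr.
Qed.

Lemma op_norm_ge0 g x : differentiable g x -> 0 <= op_norm ('d g x).
Proof.
move=> /op_norm_ubound ub; apply: ub_le_sup ub _ _.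
by exists 0; rewrite /= ?linear0 normr0.
Qed.

Lemma op_normP g x : differentiable g x ->
  forall h, `|'d g x h| <= op_norm ('d g x) * `|h|.
Proof.
move=> /op_norm_ubound ub h.
have [->|h0] := eqVneq h 0; first by rewrite linear0 !normr0 mulr0.
have nh : 0 < `|h| by rewrite normr_gt0.
rewrite -ler_pdivrMr//; apply: ub_le_sup ub _ _.
exists (`|h|^-1 *: h) => /=.
  by rewrite normrZ ger0_norm ?invr_ge0// mulVf ?gt_eqF.
by rewrite linearZ normrZ ger0_norm ?invr_ge0// mulrC.
Qed.

Lemma is_derive_line (W : normedModType R) (f : H -> W) x h (r : R) :
  differentiable f (x + r *: h) ->
  is_derive r 1 (fun r : R => f (x + r *: h)) ('d f (x + r *: h) h).
Proof.
move=> df.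
have dl : is_diff r (cst x + ( *:%R^~ h)) ( *:%R^~ h : R -> H).
  by rewrite -[X in is_diff _ _ X]add0r; exact: is_diffD.
have := @is_diff_comp _ _ _ _ _ _ _ _ r dl (differentiableP df).
move=> [/= dc dE]; apply: DeriveDef; first exact: diff_derivable.
by rewrite deriveE// dE /= scale1r.
Qed.

Lemma mean_value_grad f x k : (forall y, differentiable f y) ->
  exists2 c : R, 0 <= c <= 1 & f (x + k) - f x = <| grad f (x + c *: k), k |>.
Proof.
move=> df.
have dl (r : R) : is_derive r 1 (fun r : R => f (x + r *: k))
    <| grad f (x + r *: k), k |>.
  by rewrite -diff_grad//; exact: is_derive_line.
have [|c] := @MVT_segment R _ _ 0 1 ler01 (fun r _ => dl r).
  by apply: derivable_within_continuous => r _; case: (dl r).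
by rewrite in_itv/= scale1r scale0r addr0 subr0 mulr1 => c01 e; exists c.
Qed.

Lemma mean_value_diff g x h k : (forall y, differentiable g y) ->
  exists2 c : R, 0 <= c <= 1 &
    <| g (x + h) - g x, k |> = <| 'd g (x + c *: h) h, k |>.
Proof.
move=> dg.
have dl (r : R) : is_derive r 1 (fun r : R => <| k, g (x + r *: h) |>)
    <| k, 'd g (x + r *: h) h |>.
  have dk y : is_diff y (inner k) (inner k).
    apply: DiffDef; first exact/linear_differentiable/innerr_continuous.
    exact/diff_lin/innerr_continuous.
  have [dc dE] := is_diff_comp (differentiableP (dg (x + r *: h))) (dk _).
  have := is_derive_line _ _ x h r dc.
  by rewrite dE.
have [|c] := @MVT_segment R _ _ 0 1 ler01 (fun r _ => dl r).
  by apply: derivable_within_continuous => r _; case: (dl r).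
rewrite in_itv/= scale1r scale0r addr0 subr0 mulr1 => c01 e; exists c => //.
by rewrite innerC innerDr innerNr e innerC.
Qed.

Definition second_difference f x h k : R :=
  f (x + h + k) - f (x + h) - f (x + k) + f x.

(** The mean value theorem is applied to [r |-> f (x + h + r k) - f (x + r k)]. *)
Lemma mean_value_second_difference f x h k : (forall y, differentiable f y) ->
  exists2 c : R, 0 <= c <= 1 &
    second_difference f x h k =
    <| grad f (x + h + c *: k) - grad f (x + c *: k), k |>.
Proof.
move=> df.
have dl y (r : R) : is_derive r 1 (fun r : R => f (y + r *: k))
    <| grad f (y + r *: k), k |>.
  by rewrite -diff_grad//; exact: is_derive_line.
have dl2 (r : R) : is_derive r 1
    (fun r : R => f (x + h + r *: k) - f (x + r *: k))
    (<| grad f (x + h + r *: k), k |> - <| grad f (x + r *: k), k |>).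
  exact: is_deriveB (dl (x + h) r) (dl x r).
have [|c] := @MVT_segment R _ _ 0 1 ler01 (fun r _ => dl2 r).
  by apply: derivable_within_continuous => r _; case: (dl2 r).
rewrite in_itv/= !scale1r !scale0r !addr0 subr0 mulr1 => c01 e.
exists c => //; rewrite innerBl -e /second_difference.
ring.
Qed.

Lemma le_weighted_geometric_mean (a b z beta : R) : 0 <= z -> 0 < beta < 1 ->
  z <= a -> z <= b -> z <= a `^ (1 - beta) * b `^ beta.
Proof.
move=> z0 /andP[beta0 beta1] za zb.
have [a0 b0] := (le_trans z0 za, le_trans z0 zb).
have -> : z = z `^ (1 - beta) * z `^ beta.
  by rewrite -powRD ?subrK ?powRr1// oner_eq0.
by apply: ler_pM; rewrite ?powR_ge0//; apply: ge0_ler_powR;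
  rewrite ?nnegrE ?subr_ge0 ?(ltW beta0) ?(ltW beta1).
Qed.

(** A quantitative form of [C^{1,beta}] regularity on a ball that mentions no
    derivative.  Being linear in the values of [f], the two bounds can be
    integrated in time and pass to pointwise limits. *)
Definition C1_modulus (beta C rho : R) f : Prop := forall x h k,
  `|x| <= rho -> `|h| <= rho -> `|k| <= rho ->
  `|f (x + k) - f x| <= C * `|k| /\
  `|second_difference f x h k| <= C * `|k| * `|h| `^ beta.

(** The second difference is at most [2 a |k|] by the gradient bound and at
    most [b |h| |k|] by the Hessian bound, hence at most their geometric mean
    with weights [1 - beta] and [beta].  The three displacements of size at
    most [rho] stay in the ball of radius [3 rho]. *)
Lemma C2_modulus (beta rho a b : R) f : 0 < beta < 1 ->
  (forall x, differentiable f x) -> (forall x, differentiable (grad f) x) ->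
  (forall x, `|x| <= 3 * rho -> `|grad f x| <= a) ->
  (forall x, `|x| <= 3 * rho -> op_norm ('d (grad f) x) <= b) ->
  forall x h k, `|x| <= rho -> `|h| <= rho -> `|k| <= rho ->
  `|f (x + k) - f x| <= a * `|k| /\
  `|second_difference f x h k|
    <= (2 * a) `^ (1 - beta) * b `^ beta * `|k| * `|h| `^ beta.
Proof.
move=> beta01 df dg fa gb x h k xr hr kr.
have rho0 : 0 <= rho by exact: le_trans xr.
have a0 : 0 <= a by apply: le_trans (fa 0 _); rewrite ?normr0// mulr_ge0.
have b0 : 0 <= b.
  apply: le_trans (gb 0 _); first exact: op_norm_ge0.
  by rewrite normr0 mulr_ge0.
have scl (c : R) (y : H) : 0 <= c <= 1 -> `|y| <= rho -> `|c *: y| <= rho.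
  move=> /andP[c0 c1] yr; rewrite normrZ ger0_norm//.
  by rewrite (le_trans _ yr)// ler_piMl.
have in3 (y z w : H) : `|y| <= rho -> `|z| <= rho -> `|w| <= rho ->
    `|y + z + w| <= 3 * rho.
  move=> yr zr wr; rewrite (le_trans (ler_normD _ _))//.
  by have := ler_normD y z; lra.
have in3' (y z : H) : `|y| <= rho -> `|z| <= rho -> `|y + z| <= 3 * rho.
  by move=> yr zr; have := in3 y z 0; rewrite addr0 normr0; apply.
split.
  have [c c01 ->] := mean_value_grad _ x k df.
  rewrite (le_trans (cauchy_schwarz _ _))// ler_wpM2r//.
  by apply/fa/in3' => //; exact: scl.
have [c c01 ->] := mean_value_second_difference _ x h k df.
have ck := scl c k c01 kr.
set y := x + c *: k.
have -> : x + h + c *: k = y + h by rewrite /y addrAC.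
set z := `|_|.
have za : z <= 2 * a * `|k|.
  rewrite /z (le_trans (cauchy_schwarz _ _))// ler_wpM2r//.
  rewrite (le_trans (ler_normB _ _))// mulr_natl mulr2n lerD//; apply: fa.
    by rewrite /y addrAC; exact: in3.
  exact: in3'.
have zb : z <= b * `|h| * `|k|.
  rewrite /z; have [e e01 ->] := mean_value_diff _ y h k dg.
  rewrite (le_trans (cauchy_schwarz _ _))// ler_wpM2r//.
  rewrite (le_trans (op_normP _ _ (dg _) _))// ler_wpM2r//.
  by apply/gb/in3 => //; exact: scl.
have := le_weighted_geometric_mean _ _ _ beta (normr_ge0 _) beta01 za zb.
rewrite !powRM ?mulr_ge0// => /le_trans; apply.
rewrite mulrACA -powRD ?subrK ?oner_eq0// powRr1//.
by rewrite !mulrA le_eqVlt; apply/orP; left; apply/eqP; ring.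
Qed.

End Gradient.

(** * From finite-difference moduli to C^{1,beta} regularity *)

Lemma geometric_limit (R : realType) (u : nat -> R) (K q : R) :
  0 <= q < 1 -> (forall n, `|u n.+1 - u n| <= K * q ^+ n) ->
  cvgn u /\ forall n, `|u n - limn u| <= K / (1 - q) * q ^+ n.
Proof.
move=> /andP[q0 q1] uq.
have q1' : 0 < 1 - q by rewrite subr_gt0.
have K0 : 0 <= K by have := uq 0%N; rewrite expr0 mulr1; apply: le_trans.
have dist n j : `|u (n + j)%N - u n| <= K / (1 - q) * (q ^+ n - q ^+ (n + j)).
  elim: j => [|j IH]; first by rewrite addn0 !subrr normr0 mulr0.
  rewrite addnS -(subrK (u (n + j)%N) (u _.+1)) -addrA.
  rewrite (le_trans (ler_normD _ _))// (le_trans (lerD (uq _) IH))//.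
  rewrite le_eqVlt; apply/orP; left; apply/eqP; rewrite exprS.
  by field; rewrite gt_eqF.
have dist' n j : `|u n - u (n + j)%N| <= K / (1 - q) * q ^+ n.
  rewrite distrC (le_trans (dist n j))// ler_wpM2l ?divr_ge0 ?(ltW q1')//.
  by rewrite gerBl exprn_ge0.
have cq : (K / (1 - q) * q ^+ n) @[n --> \oo] --> 0.
  by apply: cvg_geometric; rewrite ger0_norm.
have cu : cvgn u.
  apply/cauchy_cvgP/cauchyP => e e0.
  have [N _ HN] := cvgr0_norm_lt _ cq _ e0.
  exists (u N), N => // n /= Nn.
  rewrite -ball_normE /= -(subnKC Nn) (le_lt_trans (dist' _ _))//.
  by apply: le_lt_trans (HN N _) => //=; exact: ler_norm.
split=> // n.
have c : `|u n - u k| @[k --> \oo] --> `|u n - limn u|.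
  by apply: cvg_norm; apply: cvgB => //; exact: cvg_cst.
rewrite -(cvg_lim _ c)//; apply: limr_le; first by apply/cvg_ex; eexists; exact: c.
by exists n => // k /= nk; rewrite -(subnKC nk).
Qed.

Section Modulus.
Context {R : realType} {H : hilbertType R}.
Implicit Types (x h k p : H) (F : H -> R).

Definition dyadic_quotient F x h (n : nat) : R :=
  2 ^+ n * (F (x + 2^-1 ^+ n *: h) - F x).

(** The remainder [K |h|^{1+beta}] is [o(h)]. *)
Lemma differentiable_of_estimate F x p (K beta rho : R) : 0 < beta -> 0 < rho ->
  (forall h, `|h| <= rho -> `|F (x + h) - F x - <| p, h |>| <= K * `|h| * `|h| `^ beta) ->
  differentiable F x /\ grad F x = p.
Proof.
move=> beta0 rho0 Fp.
have cp : continuous (inner p : H -> R) by exact: innerr_continuous.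
have o : F \o shift x = cst (F x) + inner p +o_ (0 : H) id.
  apply/eqaddoP => e e0.
  have /cvgr0_norm_le sm : `|K| * r `^ beta @[r --> 0^'+] --> 0.
    by rewrite -[X in _ --> X](mulr0 `|K|); apply: cvgMr; exact: powR_cvg0.
  have {sm} [r /= r0 sm] := sm _ e0.
  near=> h.
  have hrho : `|h| <= rho by near: h; exact: (@cvgr0_norm_le _ _ _ _ _ id).
  have hr : `|h| < r by near: h; exact: (@cvgr0_norm_lt _ _ _ _ _ id).
  rewrite !fctE /= (addrC h) opprD addrA (le_trans (Fp _ hrho))//.
  have [->|h0] := eqVneq h 0; first by rewrite normr0 !(mulr0, mul0r).
  rewrite -mulrA [leRHS]mulrC mulrCA ler_wpM2l//.
  apply: (@le_trans _ _ (`|K| * `|h| `^ beta)).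
    by rewrite ler_wpM2r ?powR_ge0// ler_norm.
  apply: (le_trans (ler_norm _)); apply: sm; last by rewrite normr_gt0.
  by rewrite /= sub0r normrN normr_id.
have dE : 'd F x = inner p :> (H -> R) by exact: diff_unique.
have dF : differentiable F x by apply/diff_locallyP; rewrite dE.
by split=> //; apply: inner_ext => h; rewrite -diff_grad// dE.
Unshelve. all: by end_near. Qed.

Section Quotients.
Variables (beta : R) (C : R -> R) (F : H -> R).
Hypothesis beta01 : 0 < beta < 1.
Hypothesis FC : forall rho, C1_modulus beta (C rho) rho F.

Local Notation q := (2^-1 `^ beta).
Local Notation e n := ((2^-1 : R) ^+ n).

Lemma dyadic_ratio01 : 0 <= q < 1.
Proof.
have /andP[b0 b1] := beta01; rewrite powR_ge0/=.
have := @gt0_ltr_powR R beta b0 2^-1 1.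
by rewrite powR1; apply; rewrite ?nnegrE ?invr_ge0// invf_lt1// ltr1n.
Qed.

Lemma dyadic_normr h n : `|e n *: h| = e n * `|h|.
Proof. by rewrite normrZ ger0_norm// exprn_ge0. Qed.

Lemma dyadic_le h n (rho : R) : `|h| <= rho -> `|e n *: h| <= rho.
Proof.
move=> hr; rewrite dyadic_normr (le_trans _ hr)// ler_piMl//.
by rewrite exprn_ile1// invf_le1// ler1n.
Qed.

Lemma dyadic_powR h n : `|e n *: h| `^ beta = q ^+ n * `|h| `^ beta.
Proof.
rewrite dyadic_normr powRM ?exprn_ge0//; congr (_ * _).
by rewrite -!powR_mulrn ?powR_ge0 ?invr_ge0// powRAC.
Qed.

Lemma dyadic_inv n : 2 ^+ n * e n = 1 :> R.
Proof. by rewrite -exprMn divff// expr1n. Qed.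

Lemma near_dyadic h (rho : R) : 0 < rho -> \forall n \near \oo, `|e n *: h| <= rho.
Proof.
move=> rho0.
have c : `|h| * e n @[n --> \oo] --> 0.
  by apply: cvg_geometric; rewrite ger0_norm ?invr_ge0// invf_lt1// ltr1n.
near=> n; rewrite dyadic_normr mulrC (le_trans (ler_norm _))//.
by near: n; exact: (cvgr0_norm_le _ c _ rho0).
Unshelve. all: by end_near. Qed.

(** The difference of consecutive quotients is [- 2^n] times the second
    difference at [x] with both increments equal to [2^{-n-1} h], which is of
    order [2^{-n (1 + beta)}]; the prefactor leaves the ratio [2^{-beta}]. *)
Lemma dyadic_quotient_step (rho : R) x h n : `|x| <= rho -> `|h| <= rho ->
  `|dyadic_quotient F x h n.+1 - dyadic_quotient F x h n|
    <= C rho * `|h| * `|h| `^ beta * q ^+ n.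
Proof.
move=> xr hr; set k := e n.+1 *: h.
have kr : `|k| <= rho by exact: dyadic_le.
have -> : dyadic_quotient F x h n.+1 - dyadic_quotient F x h n =
    - (2 ^+ n * second_difference F x k k).
  have nk : e n *: h = k + k.
    rewrite -scalerDl; congr (_ *: _); rewrite exprS.
    by field.
  by rewrite /dyadic_quotient /second_difference nk -/k exprS (addrA x k k); ring.
rewrite normrN normrM ger0_norm ?exprn_ge0//.
have [_ sd] := FC rho x k k xr kr kr.
have Ch : 0 <= C rho * `|h|.
  by have [/(le_trans (normr_ge0 _))] := FC rho x h h xr hr hr.
apply: (le_trans (ler_wpM2l _ sd)); first by rewrite exprn_ge0.
rewrite {2}/k dyadic_powR /k dyadic_normr.
have -> : 2 ^+ n * (C rho * (e n.+1 * `|h|) * (q ^+ n.+1 * `|h| `^ beta)) =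
    (2 ^+ n * e n) * (C rho * `|h| * `|h| `^ beta * q ^+ n) * (2^-1 * q).
  by rewrite !exprS; ring.
rewrite dyadic_inv mul1r ler_piMr//.
  by apply: mulr_ge0; rewrite ?exprn_ge0 ?powR_ge0//; apply: mulr_ge0; rewrite ?powR_ge0.
have /andP[q0 /ltW q1] := dyadic_ratio01.
by rewrite mulr_ile1// ?invr_ge0// invf_le1// ler1n.
Qed.

(** The defect of additivity of the quotients is [2^n] times a second
    difference with increments [2^{-n} h] and [2^{-n} k]. *)
Lemma quotient_additive (rho : R) x h k n :
  `|x| <= rho -> `|h| <= rho -> `|k| <= rho ->
  `|dyadic_quotient F x (h + k) n - (dyadic_quotient F x h n +
      dyadic_quotient F x k n)| <= C rho * `|k| * `|h| `^ beta * q ^+ n.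
Proof.
move=> xr hr kr.
have -> : dyadic_quotient F x (h + k) n - (dyadic_quotient F x h n +
      dyadic_quotient F x k n) =
    2 ^+ n * second_difference F x (e n *: h) (e n *: k).
  by rewrite /dyadic_quotient /second_difference scalerDr addrA; ring.
have [_ sd] := FC rho _ _ _ xr (dyadic_le _ n _ hr) (dyadic_le _ n _ kr).
rewrite normrM ger0_norm ?exprn_ge0// (le_trans (ler_wpM2l _ sd)) ?exprn_ge0//.
rewrite dyadic_powR dyadic_normr.
have -> : 2 ^+ n * (C rho * (e n * `|k|) * (q ^+ n * `|h| `^ beta)) =
    (2 ^+ n * e n) * (C rho * `|k| * `|h| `^ beta * q ^+ n) by ring.
by rewrite dyadic_inv mul1r.
Qed.

Definition quotient_rate (rho : R) h : R :=
  C rho * `|h| * `|h| `^ beta / (1 - q).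

(** The vector [p] does not depend on the radius [rho], which only enters the
    rate. *)
Lemma dyadic_quotient_limit x : exists p, forall (rho : R) h n,
  `|x| <= rho -> `|h| <= rho ->
  `|dyadic_quotient F x h n - <| p, h |>| <= quotient_rate rho h * q ^+ n.
Proof.
have lim (rho : R) h : `|x| <= rho -> `|h| <= rho ->
    cvgn (dyadic_quotient F x h) /\ forall n,
    `|dyadic_quotient F x h n - limn (dyadic_quotient F x h)|
      <= quotient_rate rho h * q ^+ n.
  move=> xr hr; apply: geometric_limit dyadic_ratio01 _ => n.
  exact: dyadic_quotient_step.
pose L h := limn (dyadic_quotient F x h).
have cL h : dyadic_quotient F x h n @[n --> \oo] --> L h.
  by have [] := lim (`|x| + `|h|) h _ _; rewrite ?lerDl ?lerDr.
have LD h k : L (h + k) = L h + L k.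
  pose rho := `|x| + `|h| + `|k|.
  have xr : `|x| <= rho by rewrite /rho -addrA lerDl addr_ge0.
  have hr : `|h| <= rho by rewrite /rho addrAC lerDr addr_ge0.
  have kr : `|k| <= rho by rewrite /rho lerDr addr_ge0.
  apply/eqP; rewrite -subr_eq0; apply/eqP.
  have c1 : dyadic_quotient F x (h + k) n - (dyadic_quotient F x h n +
      dyadic_quotient F x k n) @[n --> \oo] --> L (h + k) - (L h + L k).
    by apply: cvgB => //; apply: cvgD.
  suff c2 : dyadic_quotient F x (h + k) n - (dyadic_quotient F x h n +
      dyadic_quotient F x k n) @[n --> \oo] --> (0 : R).
    exact: (cvg_unique _ c1 c2).
  apply/cvgr0Pnorm_le => r r0.
  have cq : C rho * `|k| * `|h| `^ beta * q ^+ n @[n --> \oo] --> 0.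
    have /andP[q0 q1] := dyadic_ratio01.
    by apply: cvg_geometric; rewrite ger0_norm.
  near=> n.
  apply: (@le_trans _ _ (C rho * `|k| * `|h| `^ beta * q ^+ n)).
    exact: quotient_additive.
  apply: le_trans (ler_norm _) _.
  by near: n; exact: (cvgr0_norm_le _ cq _ r0).
have LM h : `|L h| <= C (`|x| + 1) * `|h|.
  have c : `|dyadic_quotient F x h n| @[n --> \oo] --> `|L h|.
    exact: cvg_norm.
  rewrite -(cvg_lim _ c)//; apply: limr_le; first by apply/cvg_ex; eexists; exact: c.
  have x1 : 0 < `|x| + 1 by rewrite ltr_wpDl.
  near=> n; have hn : `|e n *: h| <= `|x| + 1.
    by near: n; exact: near_dyadic.
  have xr : `|x| <= `|x| + 1 by rewrite lerDl.
  have [le1 _] := FC _ x _ _ xr hn hn.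
  rewrite normrM ger0_norm ?exprn_ge0//.
  rewrite (le_trans (ler_wpM2l _ le1)) ?exprn_ge0// dyadic_normr.
  by rewrite mulrCA [X in _ * X]mulrA dyadic_inv mul1r.
have [p Lp] := riesz _ _ LD LM.
by exists p => rho h n xr hr; rewrite -Lp; have [_ ->] := lim rho h xr hr.
Unshelve. all: by end_near. Qed.

(** The rate at [n = 0] is the first-order expansion
    [|F(x+h) - F(x) - <p, h>| <= K |h|^{1+beta}]. *)
Lemma modulus_differentiable x : differentiable F x /\
  forall (rho : R) h n, `|x| <= rho -> `|h| <= rho ->
  `|dyadic_quotient F x h n - <| grad F x, h |>| <= quotient_rate rho h * q ^+ n.
Proof.
have [p Fp] := dyadic_quotient_limit x.
have /andP[beta0 _] := beta01.
have rho0 : 0 < `|x| + 1 by rewrite ltr_wpDl.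
suff [dF ->] : differentiable F x /\ grad F x = p by [].
apply: (differentiable_of_estimate _ _ _ (C (`|x| + 1) / (1 - q)) _ _ beta0 rho0).
move=> h hr; have xr : `|x| <= `|x| + 1 by rewrite lerDl.
have := Fp _ h 0%N xr hr.
rewrite /dyadic_quotient !expr0 mul1r scale1r mulr1 => /le_trans; apply.
by rewrite /quotient_rate le_eqVlt; apply/orP; left; apply/eqP; ring.
Qed.

Lemma dyadic_quotient_cvg x h :
  dyadic_quotient F x h n @[n --> \oo] --> <| grad F x, h |>.
Proof.
have [_ Fp] := modulus_differentiable x.
have /andP[q0 q1] := dyadic_ratio01.
have xr : `|x| <= `|x| + `|h| by rewrite lerDl.
have hr : `|h| <= `|x| + `|h| by rewrite lerDr.
apply/cvgrPdist_le => r r0.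
have cq : quotient_rate (`|x| + `|h|) h * q ^+ n @[n --> \oo] --> 0.
  by apply: cvg_geometric; rewrite ger0_norm.
near=> n; rewrite distrC (le_trans (Fp _ _ _ xr hr))//.
apply: le_trans (ler_norm _) _.
by near: n; exact: (cvgr0_norm_le _ cq _ r0).
Unshelve. all: by end_near. Qed.

(** Tested against a vector [v], the increment of the gradient is the limit of
    [2^n] times second differences with increments [h] and [2^{-n} v]; take
    [v] to be this increment itself. *)
Lemma modulus_grad_holder (rho : R) x h : 0 < rho -> 0 <= C rho ->
  `|x| <= rho -> `|h| <= rho ->
  `|grad F (x + h) - grad F x| <= C rho * `|h| `^ beta.
Proof.
move=> rho0 C0 xr hr; set v := _ - _.
have c : `|dyadic_quotient F (x + h) v n - dyadic_quotient F x v n|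
    @[n --> \oo] --> `|<| v, v |>|.
  rewrite {3}/v innerBl; apply: cvg_norm; apply: cvgB; exact: dyadic_quotient_cvg.
have vv : `|<| v, v |>| <= C rho * `|v| * `|h| `^ beta.
  rewrite -(cvg_lim _ c)//; apply: limr_le; first by apply/cvg_ex; eexists; exact: c.
  near=> n; have vr : `|e n *: v| <= rho by near: n; exact: near_dyadic.
  have [_ sd] := FC rho _ _ _ xr hr vr.
  have -> : dyadic_quotient F (x + h) v n - dyadic_quotient F x v n =
      2 ^+ n * second_difference F x h (e n *: v).
    by rewrite /dyadic_quotient /second_difference; ring.
  rewrite normrM ger0_norm ?exprn_ge0//.
  rewrite (le_trans (ler_wpM2l _ sd)) ?exprn_ge0// dyadic_normr.
  have -> : 2 ^+ n * (C rho * (e n * `|v|) * `|h| `^ beta) =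
      (2 ^+ n * e n) * (C rho * `|v| * `|h| `^ beta) by ring.
  by rewrite dyadic_inv mul1r.
have [->|v0] := eqVneq v 0; first by rewrite normr0 mulr_ge0 ?powR_ge0.
rewrite -(ler_pM2l (_ : 0 < `|v|)) ?normr_gt0//.
move: vv; rewrite inner_normE ger0_norm ?exprn_ge0// expr2 => /le_trans; apply.
by rewrite mulrAC [leRHS]mulrC.
Unshelve. all: by end_near. Qed.

End Quotients.

Lemma modulus_locally_holder (beta : R) (C : R -> R) F : 0 < beta < 1 ->
  (forall rho, 0 <= C rho) -> (forall rho, C1_modulus beta (C rho) rho F) ->
  locally_holder beta (grad F).
Proof.
move=> beta01 C0 FC r r0; exists (C (2 * r)) => x y xr yr.
have {1}-> : x = y + (x - y) by rewrite addrC subrK.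
apply: modulus_grad_holder => //.
- by rewrite mulr_gt0.
- by lra.
- by rewrite (le_trans (ler_normB _ _))// mulr_natl mulr2n lerD.
Qed.

Lemma locally_holder_continuous (beta : R) (g : H -> H) : 0 < beta ->
  locally_holder beta g -> continuous g.
Proof.
move=> beta0 gh x.
have rho0 : 0 < `|x| + 1 by rewrite ltr_wpDl.
have [K gK] := gh _ rho0.
apply/cvgrPdist_le => e e0.
have K0 : 0 < `|K| + 1 by rewrite ltr_wpDl.
have d0 : 0 < (e / (`|K| + 1)) `^ beta^-1 by apply: powR_gt0; rewrite divr_gt0.
near=> y.
have xy1 : `|x - y| <= 1.
  near: y; exact: (@cvgr_dist_le _ _ _ _ _ id _ (@cvg_id _ (nbhs x))).
have xyd : `|x - y| <= (e / (`|K| + 1)) `^ beta^-1.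
  near: y; exact: (@cvgr_dist_le _ _ _ _ _ id _ (@cvg_id _ (nbhs x))).
have xr : `|x| <= `|x| + 1 by rewrite lerDl.
have yr : `|y| <= `|x| + 1.
  rewrite -[y](subKr x) (le_trans (ler_normB _ _))// lerD//.
apply: (le_trans (gK _ _ xr yr)).
apply: (@le_trans _ _ ((`|K| + 1) * `|x - y| `^ beta)).
  by rewrite ler_wpM2r ?powR_ge0// (le_trans (ler_norm K))// lerDl.
rewrite mulrC -ler_pdivlMr//.
apply: (@le_trans _ _ (((e / (`|K| + 1)) `^ beta^-1) `^ beta)).
  by apply: ge0_ler_powR; rewrite ?nnegrE ?(ltW beta0) ?(ltW d0).
by rewrite -powRrM mulVf ?gt_eqF// powRr1// divr_ge0// ltW.
Unshelve. all: by end_near. Qed.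

Lemma modulus_limit (beta C rho : R) (Fn : nat -> H -> R) F :
  (forall n, C1_modulus beta C rho (Fn n)) ->
  (forall x, Fn n x @[n --> \oo] --> F x) -> C1_modulus beta C rho F.
Proof.
move=> FC cF x h k xr hr kr.
have lim (a : nat -> R) (l B : R) : a n @[n --> \oo] --> l ->
    (forall n, `|a n| <= B) -> `|l| <= B.
  move=> al aB; have c : `|a n| @[n --> \oo] --> `|l| by exact: cvg_norm.
  rewrite -(cvg_lim _ c)//; apply: limr_le; first by apply/cvg_ex; eexists; exact: c.
  by near=> n.
split.
  apply: (lim (fun n => Fn n (x + k) - Fn n x)) => [|n]; first exact: cvgB.
  by have [] := FC n x h k xr hr kr.
apply: (lim (fun n => second_difference (Fn n) x h k)) => [|n].
  by apply: cvgD => //; apply: cvgB => //; exact: cvgB.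
by have [] := FC n x h k xr hr kr.
Unshelve. all: by end_near. Qed.

Lemma dist_thirds (a b c d e : R) : `|a - c| <= e / 3 -> `|b - d| <= e / 3 ->
  `|a - b| <= e / 3 -> `|c - d| <= e.
Proof.
rewrite !ler_norml => /andP[ac1 ac2] /andP[bd1 bd2] /andP[ab1 ab2].
by apply/andP; split; lra.
Qed.

(** At a fixed dyadic level [j] the quotients of [Fn n] converge to those of
    [F], and they differ from the gradients by an amount that is small for
    large [j], uniformly in [n]. *)
Lemma modulus_grad_weak_cvg (beta : R) (C : R -> R) (Fn : nat -> H -> R) F x :
  0 < beta < 1 ->
  (forall n rho, C1_modulus beta (C rho) rho (Fn n)) ->
  (forall x, Fn n x @[n --> \oo] --> F x) ->
  weakly_converges (fun n => grad (Fn n) x) (grad F x).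
Proof.
move=> beta01 FnC cF h.
have FC rho : C1_modulus beta (C rho) rho F by exact: modulus_limit cF.
have [_ Fp] := modulus_differentiable beta C F beta01 FC x.
have Fnp n := (modulus_differentiable beta C (Fn n) beta01 (FnC n) x).2.
have xr : `|x| <= `|x| + `|h| by rewrite lerDl.
have hr : `|h| <= `|x| + `|h| by rewrite lerDr.
have /andP[q0 q1] := dyadic_ratio01 _ beta01.
have cq : quotient_rate beta C (`|x| + `|h|) h * (2^-1 `^ beta) ^+ j
    @[j --> \oo] --> 0.
  by apply: cvg_geometric; rewrite ger0_norm.
suff near_grad (e : R) : 0 < e -> \forall n \near \oo,
    `|<| grad F x, h |> - <| grad (Fn n) x, h |>| <= e by exact/cvgrPdist_le.
move=> e0; have e3 : 0 < e / 3 by rewrite divr_gt0.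
have [j _ /(_ j (leqnn j))/= qj] := cvgr0_norm_le _ cq _ e3.
have {}qj := le_trans (ler_norm _) qj.
have cj : dyadic_quotient (Fn n) x h j @[n --> \oo] --> dyadic_quotient F x h j.
  by apply: cvgMr; apply: cvgB.
near=> n.
have F1 := le_trans (Fp _ h j xr hr) qj.
have F2 := le_trans (Fnp n _ h j xr hr) qj.
apply: (dist_thirds _ _ _ _ _ F1 F2).
by near: n; exact: (cvgr_dist_le _ _ cj).
Unshelve. all: by end_near. Qed.

End Modulus.

(** * Time integrals with an integrable singularity *)

Section SingularIntegral.
Context {R : realType}.
Local Notation mu := (@lebesgue_measure R).

Lemma is_derive_power_shift (t p s : R) : p < 1 -> t < s ->
  is_derive s 1 (fun s => (1 - p)^-1 * (s - t) `^ (1 - p)) ((s - t) `^ (- p)).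
Proof.
move=> p1 ts.
have p0 : 1 - p != 0 by rewrite gt_eqF ?subr_gt0.
have ds : is_derive s 1 (fun s : R => s - t) 1.
  by apply: is_derive_eq; rewrite subr0.
have st : 0 < s - t by rewrite subr_gt0.
have dp := @is_derive1_comp R (@powR R ^~ (1 - p)) (fun s => s - t) s _ _
    (is_derive1_powR (1 - p) st) ds.
have dz := is_deriveZ (1 - p)^-1 dp.
refine (is_derive_eq dz _).
rewrite mulr1 /GRing.scale/= mulrA mulVf// mul1r.
by congr (_ `^ _); ring.
Qed.

Lemma measurable_power_shift (t p : R) (D : set R) :
  measurable_fun D (fun s : R => ((s - t) `^ (- p))%:E).
Proof.
apply/measurable_EFinP; apply: (measurable_funS measurableT) => //.
apply: (measurableT_comp (measurable_powR (- p))).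
exact: measurable_funB.
Qed.

Lemma integral_power_away (t T p a : R) : p < 1 -> t < a -> a < T ->
  (\int[mu]_(s in `[a, T]) ((s - t) `^ (- p))%:E =
  ((1 - p)^-1 * (T - t) `^ (1 - p) - (1 - p)^-1 * (a - t) `^ (1 - p))%:E)%E.
Proof.
move=> p1 ta aT; rewrite EFinB.
have dF s : t < s -> is_derive s 1 (fun s => (1 - p)^-1 * (s - t) `^ (1 - p)) _ :=
  is_derive_power_shift t p s p1.
have cF s : t < s ->
    {for s, continuous (fun s => (1 - p)^-1 * (s - t) `^ (1 - p))}.
  by move=> /dF[d _]; exact/differentiable_continuous/derivable1_diffP.
rewrite (@continuous_FTC2 _ _ (fun s => (1 - p)^-1 * (s - t) `^ (1 - p)))//.
- apply: derivable_within_continuous => s; rewrite in_itv/= => /andP[as_ _].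
  have st : 0 < s - t by rewrite subr_gt0 (lt_le_trans ta).
  have ds : is_derive s 1 (fun s : R => s - t) 1.
    by apply: is_derive_eq; rewrite subr0.
  by have [] := @is_derive1_comp R (@powR R ^~ (- p)) (fun s => s - t) s _ _
    (is_derive1_powR (- p) st) ds.
- split.
  + by move=> s; rewrite in_itv/= => /andP[as_ _]; have [] := dF s (lt_trans ta as_).
  + exact/cvg_at_right_filter/cF.
  + exact/cvg_at_left_filter/cF/(lt_trans ta).
- move=> s; rewrite in_itv/= => /andP[as_ _].
  by rewrite derive1E; have [] := dF s (lt_trans ta as_).
Qed.

(** The exponent being less than 1, the primitive of the integrand stays
    bounded up to the singularity. *)
Lemma integral_power_le (t T p : R) : p < 1 -> t < T ->
  (\int[mu]_(s in `]t, T]) ((s - t) `^ (- p))%:E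
    <= ((1 - p)^-1 * (T - t) `^ (1 - p))%:E)%E.
Proof.
move=> p1 tT.
have Tt : 0 < T - t by rewrite subr_gt0.
(* n.+2 rather than n.+1 keeps a n strictly below T. *)
pose a n := t + (T - t) / n.+2%:R.
have ta n : t < a n by rewrite ltrDl divr_gt0.
have aT n : a n < T.
  by rewrite -ltrBrDl ltr_pdivrMr// ltr_pMr// ltr1n.
have -> : `]t, T]%classic = \bigcup_n `[a n, T]%classic.
  apply/seteqP; split => s /=; last first.
    by move=> [n _] /=; rewrite !in_itv/= => /andP[/(lt_le_trans (ta n)) -> ->].
  rewrite in_itv/= => /andP[ts sT].
  have st : 0 < (s - t) / (T - t) by rewrite divr_gt0// subr_gt0.
  have [n _ /(_ n (leqnn n))/= hn] := near_infty_natSinv_lt (PosNum st).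
  exists n => //=; rewrite in_itv/= sT andbT -lerBrDl.
  rewrite mulrC -ler_pdivlMr// (le_trans _ (ltW hn))//.
  by rewrite lef_pV2 ?posrE// ler_nat.
have mono : nondecreasing_seq (fun n => `[a n, T]%classic).
  move=> i j ij; apply/subsetPset => s /=; rewrite !in_itv/= => /andP[+ ->].
  rewrite andbT; apply: le_trans; rewrite lerD2l ler_pM2l//.
  by rewrite lef_pV2 ?posrE// ler_nat.
have c := ge0_nondecreasing_set_cvg_integral (mu := mu) mono
  (fun n => measurable_itv _) (fun n => measurable_power_shift t p _)
  (fun n s _ => powR_ge0 (s - t) (- p) : (0 <= ((s - t) `^ (- p))%:E)%E).
rewrite -(cvg_lim _ c)//; apply: lime_le; first by apply/cvg_ex; eexists; exact: c.
near=> n; rewrite integral_power_away// lee_fin gerBl.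
by rewrite mulr_ge0 ?powR_ge0// invr_ge0 subr_ge0 ltW.
Unshelve. all: by end_near. Qed.

Lemma Rintegral_singular_le (t T p B : R) (G : R -> R) : p < 1 -> t < T ->
  mu.-integrable `[t, T] (EFin \o G) ->
  (forall s, t < s <= T -> `|G s| <= B * (s - t) `^ (- p)) ->
  `|\int[mu]_(s in `[t, T]) G s| <= B * ((1 - p)^-1 * (T - t) `^ (1 - p)).
Proof.
move=> p1 tT iG GB.
have B0 : 0 <= B.
  have := GB T; rewrite tT lexx => /(_ isT)/(le_trans (normr_ge0 _)).
  by rewrite pmulr_lge0// powR_gt0// subr_gt0.
have iG' : mu.-integrable `]t, T] (EFin \o G).
  apply: integrableS iG => //.
  by apply: subset_itvr; rewrite bnd_simp.
rewrite -Rintegral_itv_obnd_cbnd//.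
rewrite -lee_fin EFin_normr_Rintegral//.
apply: (le_trans (le_abse_integral _ _ _)) => //; first by case/integrableP: iG'.
rewrite EFinM.
apply: (@le_trans _ _ (B%:E * \int[mu]_(s in `]t, T]) ((s - t) `^ (- p))%:E)%E);
  last by apply: lee_wpmul2l; [rewrite lee_fin|exact: integral_power_le].
rewrite -ge0_integralZl_EFin//; last exact: measurable_power_shift.
  apply: ge0_le_integral => //.
  - by apply: measurableT_comp => //; case/integrableP: iG'.
  - apply/measurable_EFinP/measurable_funM => //.
    by apply/measurable_EFinP; exact: measurable_power_shift.
by move=> s _; rewrite lee_fin powR_ge0.
Qed.

End SingularIntegral.

(** * Weighted norms *)

Section Weighted.
Context {R : realType} {H : hilbertType R}.
Implicit Types (x y : H) (phi : H -> R) (psi : R -> H -> R).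

Lemma weight_gt0 (m : R) x : 0 < weight m x.
Proof. by rewrite /weight ltr_pwDl ?powR_ge0. Qed.

Lemma Bnorm_le (m N : R) phi : (forall x, `|phi x| <= N * weight m x) ->
  (Bnorm m phi <= N%:E)%E.
Proof.
move=> phiN; apply: ge_ereal_sup => _ [x _ <-].
by rewrite lee_fin ler_pdivrMr ?weight_gt0.
Qed.

Lemma Bnorm_bound (m : R) phi : (Bnorm m phi < +oo)%E ->
  exists2 N : R, 0 <= N & (Bnorm m phi <= N%:E)%E.
Proof.
move=> phioo; exists (fine (Bnorm m phi)).
  apply: fine_ge0; apply: le_trans (ereal_sup_ubound _); last by exists 0.
  by rewrite lee_fin divr_ge0// ltW// weight_gt0.
have /andP[] : (-oo < Bnorm m phi < +oo)%E.
  rewrite phioo andbT; apply: lt_le_trans (ereal_sup_ubound _); last by exists 0.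
  exact: ltNyr.
by move=> n1 n2; rewrite fineK// fin_real// n1.
Qed.

Lemma BnormT_le (T m N s : R) psi x : (BnormT T m psi <= N%:E)%E ->
  0 <= s <= T -> `|psi s x| <= N * weight m x.
Proof.
move=> psiN sT; rewrite -ler_pdivrMr ?weight_gt0// -lee_fin.
apply: le_trans psiN; apply: ereal_sup_ubound.
by exists (s, x) => //; split => //=; rewrite in_itv.
Qed.

Lemma BnormT_bound (T m : R) psi : (BnormT T m psi < +oo)%E ->
  exists N : R, (BnormT T m psi <= N%:E)%E.
Proof.
case: (BnormT T m psi) => [N _|//|_]; first by exists N.
by exists 0; exact: leNye.
Qed.

Lemma measurable_section (T s : R) psi : 0 <= s <= T ->
  measurable_fun (`[0, T] `*` [set: H] : set (borel (R * H)%type))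
    (fun p => psi p.1 p.2) ->
  measurable_fun [set: borel H] (psi s).
Proof.
move=> sT mpsi.
pose i (y : borel H) : borel (R * H)%type := (s, y).
have ci : continuous ((fun y => (s, y)) : H -> R * H).
  by move=> y; apply: (@cvg_pair _ _ _ _ (nbhs s) (nbhs y)); [exact: cvg_cst|exact: cvg_id].
have mi : measurable_fun [set: borel H] i.
  apply: (@measurability _ _ _ _ _ i (@open (R * H)%type) erefl) => _ [U oU <-].
  apply: sub_sigma_algebra; rewrite setTI.
  by apply: open_comp => // y _; exact: ci.
have cD : closed (`[0, T] `*` [set: H] : set (R * H)).
  have -> : `[0, T] `*` [set: H] = fst @^-1` `[0, T].
    by apply/seteqP; split => y //= [].
  apply: preimage_closed; last exact: itv_closed.
  by move=> y _; exact: cvg_fst.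
have mD : measurable (`[0, T] `*` [set: H] : set (borel (R * H)%type)).
  rewrite -[X in measurable X]setCK; apply: measurableC.
  by apply: sub_sigma_algebra; exact: closed_openC.
apply: (measurable_comp mD _ mpsi mi).
by move=> _ [y _ <-]; split => //=; rewrite in_itv.
Qed.

End Weighted.

(** * Finite-difference moduli of the penalized solutions *)

Section IntegralModulus.
Context {R : realType} {H : hilbertType R}.
Implicit Types (x h k : H) (F G : H -> R).

(** The value of [\int_t^T (s - t)^{-p} ds] for [p < 1] and [t < T]. *)
Definition singular_mass (t T p : R) : R := (1 - p)^-1 * (T - t) `^ (1 - p).

Lemma singular_mass_ge0 (t T p : R) : p < 1 -> 0 <= singular_mass t T p.
Proof. by move=> p1; rewrite mulr_ge0 ?powR_ge0// invr_ge0 subr_ge0 ltW. Qed.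

Lemma C1_modulusD (beta rho c1 c2 : R) F G :
  C1_modulus beta c1 rho F -> C1_modulus beta c2 rho G ->
  C1_modulus beta (c1 + c2) rho (F \+ G).
Proof.
move=> FC GC x h k xr hr kr.
have [F1 F2] := FC x h k xr hr kr; have [G1 G2] := GC x h k xr hr kr.
split.
  have -> : (F \+ G) (x + k) - (F \+ G) x = (F (x + k) - F x) + (G (x + k) - G x).
    by rewrite /=; ring.
  by rewrite mulrDl (le_trans (ler_normD _ _))// lerD.
have -> : second_difference (F \+ G) x h k =
    second_difference F x h k + second_difference G x h k.
  by rewrite /second_difference /=; ring.
by rewrite !mulrDl (le_trans (ler_normD _ _))// lerD.
Qed.

(** Both estimates are linear in the values of [G s], so they pass through
    the integral with the powers of [s - t] replaced by their masses. *)
Lemma integral_modulus (t T beta p1 p2 b1 b2 rho : R) (G : R -> H -> R) :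
  t < T -> p1 < 1 -> p2 < 1 -> 0 <= b1 -> 0 <= b2 ->
  (forall x, lebesgue_measure.-integrable `[t, T] (EFin \o (fun s => G s x))) ->
  (forall s x h k, t < s <= T -> `|x| <= rho -> `|h| <= rho -> `|k| <= rho ->
    `|G s (x + k) - G s x| <= b1 * (s - t) `^ (- p1) * `|k| /\
    `|second_difference (G s) x h k|
      <= b2 * (s - t) `^ (- p2) * `|k| * `|h| `^ beta) ->
  C1_modulus beta (b1 * singular_mass t T p1 + b2 * singular_mass t T p2) rho
    (fun x => \int[lebesgue_measure]_(s in `[t, T]) G s x).
Proof.
move=> tT p11 p21 b10 b20 iG GC x h k xr hr kr.
have iB (f g : R -> R) : lebesgue_measure.-integrable `[t, T] (EFin \o f) ->
    lebesgue_measure.-integrable `[t, T] (EFin \o g) ->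
    lebesgue_measure.-integrable `[t, T] (EFin \o (f \- g)).
  by move=> fi gi; exact: (integrableB _ fi gi).
have S1 := singular_mass_ge0 t T p1 p11; have S2 := singular_mass_ge0 t T p2 p21.
split.
  rewrite -RintegralB//.
  apply: (@le_trans _ _ (b1 * `|k| * singular_mass t T p1)).
    apply: Rintegral_singular_le => //; first exact: iB.
    by move=> s ts; have [+ _] := GC s x h k ts xr hr kr; rewrite mulrAC.
  rewrite mulrAC ler_wpM2r// lerDl mulr_ge0//.
have -> : second_difference (fun x => \int[lebesgue_measure]_(s in `[t, T]) G s x) x h k
    = \int[lebesgue_measure]_(s in `[t, T])
        ((G s (x + h + k) - G s (x + h)) - (G s (x + k) - G s x)).
  rewrite RintegralB//; [|exact: iB|exact: iB].
  by rewrite RintegralB// RintegralB// /second_difference; ring.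
apply: (@le_trans _ _ (b2 * `|k| * `|h| `^ beta * singular_mass t T p2)).
  apply: Rintegral_singular_le => //; first by apply: (iB); exact: iB.
  move=> s ts; have [_] := GC s x h k ts xr hr kr.
  have -> : second_difference (G s) x h k =
      (G s (x + h + k) - G s (x + h)) - (G s (x + k) - G s x).
    by rewrite /second_difference; ring.
  by move=> /le_trans; apply; rewrite le_eqVlt; apply/orP; left; apply/eqP; ring.
rewrite (_ : b2 * _ * _ * _ = b2 * singular_mass t T p2 * `|k| * `|h| `^ beta).
  by rewrite -!(mulrA _ `|k|) ler_wpM2r ?mulr_ge0 ?powR_ge0// lerDr mulr_ge0.
by ring.
Qed.

End IntegralModulus.

Section Transition.
Context {R : realType} {H : hilbertType R}.
Context {d : measure_display} {Omega : measurableType d}.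
Context (P : probability Omega R) (T m gamma : R) (X : R -> H -> R -> Omega -> H).
Implicit Types (x h k : H) (phi : H -> R).

(** An upper bound of the weight on the ball of radius [3 rho] in which
    [C2_modulus] takes place. *)
Definition ball_weight (rho : R) : R := 1 + (3 * rho) `^ m.

Lemma ball_weight_ge0 (rho : R) : 0 <= ball_weight rho.
Proof. by rewrite addr_ge0 ?powR_ge0. Qed.

Lemma weight_le_ball (rho : R) x : 0 <= m -> `|x| <= 3 * rho ->
  weight m x <= ball_weight rho.
Proof.
move=> m0 xr; rewrite lerD2l; apply: ge0_ler_powR => //; rewrite nnegrE//.
exact: le_trans xr.
Qed.

(** The exponents combine as [g (1 - beta) + 2 g beta = g (1 + beta)]. *)
Lemma power_interpolation (M tau g beta : R) : 0 <= M -> 0 < tau -> 0 < beta < 1 ->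
  (2 * (M * tau `^ (- g))) `^ (1 - beta) * (M * tau `^ (- (2 * g))) `^ beta
    <= 2 * M * tau `^ (- (g * (1 + beta))).
Proof.
move=> M0 tau0 /andP[b0 b1].
have t0 (r : R) : 0 <= tau `^ r by exact: powR_ge0.
apply: (@le_trans _ _ ((2 * M * tau `^ (- g)) `^ (1 - beta) *
    (2 * M * tau `^ (- (2 * g))) `^ beta)).
  rewrite mulrA ler_wpM2l ?powR_ge0//; apply: ge0_ler_powR.
  - exact: ltW.
  - by rewrite nnegrE mulr_ge0.
  - by rewrite nnegrE !mulr_ge0.
  - by rewrite ler_wpM2r// ler_peMl// ler1n.
rewrite !(powRM _ (mulr_ge0 _ M0)) ?mulr_ge0//.
rewrite mulrACA -powRD; last by rewrite subrK oner_eq0.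
rewrite subrK powRr1 ?mulr_ge0// -!powRrM -powRD; last first.
  by apply/implyP => _; rewrite gt_eqF.
by rewrite (_ : _ + _ = - (g * (1 + beta))); last by ring.
Qed.

Hypothesis m0 : 0 <= m.
Variable C1 : R.
Hypothesis C1_gt0 : 0 < C1.
Hypothesis smooth : forall t s phi, 0 <= t -> t < s -> s <= T -> in_B m phi ->
  twice_continuously_differentiable (transition P X t s phi).
Hypothesis smooth_bound : forall t s phi x, 0 <= t -> t < s -> s <= T -> in_B m phi ->
  (`|grad (transition P X t s phi) x|%:E
     <= (C1 * (s - t) `^ (- gamma) * weight m x)%:E * Bnorm m phi)%E /\
  ((op_norm ('d (grad (transition P X t s phi)) x))%:E
     <= (C1 * (s - t) `^ (- (2 * gamma)) * weight m x)%:E * Bnorm m phi)%E.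

(** On the ball the derivatives of [P_{t,s} phi] are bounded by
    [M (s - t)^{-gamma}] and [M (s - t)^{-2 gamma}]; the Hölder constant is
    obtained by interpolation. *)
Lemma transition_modulus (beta N t s rho : R) phi : 0 < beta < 1 -> 0 <= N ->
  0 <= t -> t < s -> s <= T -> in_B m phi -> (Bnorm m phi <= N%:E)%E ->
  forall x h k, `|x| <= rho -> `|h| <= rho -> `|k| <= rho ->
  let M := C1 * N * ball_weight rho in
  `|transition P X t s phi (x + k) - transition P X t s phi x|
    <= M * (s - t) `^ (- gamma) * `|k| /\
  `|second_difference (transition P X t s phi) x h k|
    <= 2 * M * (s - t) `^ (- (gamma * (1 + beta))) * `|k| * `|h| `^ beta.
Proof.
move=> beta01 N0 t0 ts sT phiB phiN x h k xr hr kr M.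
have [dphi ddphi _] := smooth t s phi t0 ts sT phiB.
have M0 : 0 <= M by rewrite !mulr_ge0 ?ball_weight_ge0// ltW.
have weighted (z g : R) (y : H) : `|y| <= 3 * rho ->
    (z%:E <= (C1 * (s - t) `^ g * weight m y)%:E * Bnorm m phi)%E ->
    z <= M * (s - t) `^ g.
  move=> yr zle; rewrite -lee_fin (le_trans zle)//.
  have c0 : 0 <= C1 * (s - t) `^ g by rewrite mulr_ge0 ?powR_ge0// ltW.
  apply: (@le_trans _ _ ((C1 * (s - t) `^ g * weight m y)%:E * N%:E)%E).
    by apply: lee_wpmul2l => //; rewrite lee_fin mulr_ge0// ltW// weight_gt0.
  rewrite -EFinM lee_fin.
  have -> : M * (s - t) `^ g = C1 * (s - t) `^ g * ball_weight rho * N.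
    by rewrite /M; ring.
  by rewrite ler_wpM2r// ler_wpM2l// weight_le_ball.
have [L1 L2] := C2_modulus beta rho _ _ _ beta01 dphi ddphi
  (fun y yr => weighted _ _ y yr (smooth_bound t s phi y t0 ts sT phiB).1)
  (fun y yr => weighted _ _ y yr (smooth_bound t s phi y t0 ts sT phiB).2)
  x h k xr hr kr.
split=> //; apply: (le_trans L2).
rewrite -!(mulrA _ `|k|) ler_wpM2r ?mulr_ge0 ?powR_ge0//.
by apply: power_interpolation => //; rewrite subr_gt0.
Qed.

Lemma penalized_source_in_B (f Phi v : R -> H -> R) (eps N s : R) :
  0 <= s <= T -> in_BT T m f -> in_BT T m Phi -> in_BT T m v ->
  (forall x, `|f s x - penalization Phi eps v s x| <= N * weight m x) ->
  in_B m (fun x => f s x - penalization Phi eps v s x) /\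
  (Bnorm m (fun x => f s x - penalization Phi eps v s x)%R <= N%:E)%E.
Proof.
move=> sT [mf _] [mPhi _] [mv _] qN.
have BN := Bnorm_le _ _ _ qN.
split=> //; split; last by apply: le_lt_trans BN _; rewrite ltry.
apply: measurable_funB; first exact: measurable_section mf.
apply: measurable_funM => //.
apply: measurable_maxr => //; apply: measurable_funB.
  exact: measurable_section mv.
exact: measurable_section mPhi.
Qed.

(** Admissibility bounds the source [f - Pi_eps] of the mild equation
    independently of [eps], and the moduli of [P_{t,s}] depend on the source
    only through its weighted norm. *)
Lemma penalized_modulus (f Phi : R -> H -> R) (Psi : H -> R) (u : R -> R -> H -> R)
    (beta t : R) :
  data_assumptions T m f Phi Psi -> admissible T m Phi u ->
  (forall eps, 0 < eps -> penalized_solution P T m X f Phi Psi eps (u eps)) ->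
  0 < beta < 1 -> 0 < gamma -> gamma * (1 + beta) < 1 -> 0 <= t < T ->
  exists C : R -> R, (forall rho, 0 <= C rho) /\
    forall eps rho, 0 < eps -> C1_modulus beta (C rho) rho (u eps t).
Proof.
move=> [[[fB _] _] [[PhiB _] _] [[PsiB _] _] _] [K K0 uK] sol beta01 g0 gb.
move=> /andP[t0 tT].
have /andP[b0 b1] := beta01.
have g1 : gamma < 1 by apply: le_lt_trans gb; rewrite ler_pMr// lerDl ltW.
have [N0 N00 PsiN] := Bnorm_bound _ _ PsiB.2.
have [Nf fN] := BnormT_bound _ _ _ fB.2.
pose N1 := `|Nf| + K.
have N10 : 0 <= N1 by rewrite addr_ge0// ltW.
pose A0 rho := C1 * N0 * ball_weight rho.
pose A1 rho := C1 * N1 * ball_weight rho.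
have A00 rho : 0 <= A0 rho by rewrite !mulr_ge0 ?ball_weight_ge0// ltW.
have A10 rho : 0 <= A1 rho by rewrite !mulr_ge0 ?ball_weight_ge0// ltW.
(* c0 bounds the terminal term, at the positive time T - t, and c1 the
   integral of the source; each is the sum of the constants of the first and
   second differences. *)
pose c0 rho := A0 rho * (T - t) `^ (- gamma) +
  2 * A0 rho * (T - t) `^ (- (gamma * (1 + beta))).
pose c1 rho := A1 rho * singular_mass t T gamma +
  2 * A1 rho * singular_mass t T (gamma * (1 + beta)).
exists (fun rho => c0 rho + c1 rho); split => [rho|eps rho eps0].
  by do 2 apply: addr_ge0; apply: mulr_ge0;
    rewrite ?powR_ge0 ?singular_mass_ge0 // mulr_ge0.
have [uB ueq] := sol eps eps0.
pose G s x := transition P X t s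
  (fun y => f s y - penalization Phi eps (u eps) s y) x.
have tT' : 0 <= t <= T by rewrite t0 ltW.
have iG x := (ueq t x tT').1.
have -> : u eps t = transition P X t T Psi \+
    (fun x => \int[lebesgue_measure]_(s in `[t, T]) G s x).
  by apply/funext => x; rewrite (ueq t x tT').2.
apply: C1_modulusD.
  move=> x h k xr hr kr.
  have [L1 L2] := transition_modulus beta N0 t T rho Psi beta01 N00 t0 tT
    (lexx T) PsiB PsiN x h k xr hr kr.
  split.
    apply: (le_trans L1); rewrite ler_wpM2r// lerDl.
    by apply: mulr_ge0; rewrite ?powR_ge0// mulr_ge0.
  apply: (le_trans L2).
  rewrite -!(mulrA _ `|k|) ler_wpM2r ?mulr_ge0 ?powR_ge0// lerDr.
  by apply: mulr_ge0; rewrite ?powR_ge0.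
apply: integral_modulus => //; first by rewrite mulr_ge0.
move=> s x h k /andP[ts sT].
have s0T : 0 <= s <= T by rewrite sT (le_trans t0)// ltW.
have qN y : `|f s y - penalization Phi eps (u eps) s y| <= N1 * weight m y.
  have pN : (BnormT T m (penalization Phi eps (u eps)) <= K%:E)%E.
    by apply: le_trans uK; apply: ereal_sup_ubound; exists eps.
  rewrite (le_trans (ler_normB _ _))// mulrDl lerD//.
    apply: le_trans (BnormT_le _ _ _ _ _ _ fN s0T) _.
    by rewrite ler_wpM2r ?ler_norm// ltW// weight_gt0.
  exact: (BnormT_le _ _ _ _ _ _ pN s0T).
have [qB qBN] := penalized_source_in_B _ _ _ _ _ _ s0T fB PhiB uB qN.
exact: transition_modulus.
Qed.

End Transition.

(** * Passage to the limit *)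

Theorem theorem5p7 (R : realType) (H Xi : hilbertType R)
  (sepH : separable H) (sepXi : separable Xi)
  (T : R) (T_gt0 : 0 < T)
  (d : measure_display) (Omega : measurableType d) (P : probability Omega R)
  (F : R -> set (set Omega)) (usualF : usual_conditions P F)
  (W : R -> Xi -> Omega -> R) (wienerW : cylindrical_wiener P F W)
  (m : R) (m_ge1 : 1 <= m)
  (domA : set H) (A : H -> H) (S : R -> H -> H)
  (b : R -> H -> H) (sigma : R -> H -> Xi -> H)
  (coeff : coefficient_assumptions T domA A S b sigma)
  (X : R -> H -> R -> Omega -> H)
  (state : forall (t : R) (x : H), 0 <= t <= T ->
     mild_solution P F W T S b sigma t x (X t x))
  (gamma : R) (gamma01 : 0 < gamma < 1)
  (smoothing : smoothing_assumption P T m gamma X)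
  (f Phi : R -> H -> R) (Psi : H -> R)
  (data : data_assumptions T m f Phi Psi)
  (u : R -> R -> H -> R)
  (penalized : forall eps : R, 0 < eps ->
     penalized_solution P T m X f Phi Psi eps (u eps))
  (admissiblePhi : admissible T m Phi u)
  (V : R -> H -> R)
  (limV : forall (t : R) (x : H), 0 <= t <= T ->
     u eps t x @[eps --> 0^'+] --> V t x) :
  forall t : R, 0 <= t < T ->
  exists g : H -> H,
    [/\ forall x : H, exists eps : nat -> R,
          [/\ forall n, 0 < eps n,
              eps n @[n --> \oo] --> 0,
              forall n, differentiable (u (eps n) t) x &
              weakly_converges (fun n => grad (u (eps n) t) x) (g x)],
        forall beta : R, 0 < beta < 1 -> gamma * (1 + beta) < 1 ->
          locally_holder beta g,
        (forall x : H, differentiable (V t) x) /\ grad (V t) = g &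
        forall beta : R, 0 < beta < 1 -> gamma * (1 + beta) < 1 ->
          C1_loc beta (V t)].
Proof.
have /andP[gamma0 gamma1] := gamma01.
have m0 : 0 <= m by apply: le_trans m_ge1.
case: smoothing => smooth [C1 C1_gt0 smooth_bound].
move=> t tT; have tT' : 0 <= t <= T by have /andP[-> /ltW ->] := tT.
have modulus beta : 0 < beta < 1 -> gamma * (1 + beta) < 1 ->
    exists C : R -> R, (forall rho, 0 <= C rho) /\
      forall eps rho, 0 < eps -> C1_modulus beta (C rho) rho (u eps t).
  by move=> beta01 gb; exact: (penalized_modulus P T m gamma X m0 C1 C1_gt0
    smooth smooth_bound f Phi Psi u).
pose eps n : R := n.+1%:R^-1.
have eps0 n : 0 < eps n by rewrite invr_gt0.
have cv x : u (eps n) t x @[n --> \oo] --> V t x.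
  have /cvg_at_rightP := limV t x tT'; apply; split => //.
  exact: cvg_harmonic.
have modulusV beta : 0 < beta < 1 -> gamma * (1 + beta) < 1 ->
    exists C : R -> R, (forall rho, 0 <= C rho) /\
      forall rho, C1_modulus beta (C rho) rho (V t).
  move=> beta01 gb; have [C [C0 uC]] := modulus beta beta01 gb.
  exists C; split=> // rho.
  by apply: (modulus_limit _ _ _ (fun n => u (eps n) t)) cv => n; exact: uC.
(* Some admissible exponent: gamma (1 + beta0) < 1 amounts to
   (1 - gamma) (2 - gamma) > 0. *)
pose beta0 := (1 - gamma) / 2.
have beta001 : 0 < beta0 < 1 by rewrite /beta0; apply/andP; split; lra.
have gb0 : gamma * (1 + beta0) < 1 by rewrite /beta0; nra.
have [C [C0 uC]] := modulus beta0 beta001 gb0.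
have [CV [_ VC]] := modulusV beta0 beta001 gb0.
have dV x := (modulus_differentiable _ _ _ beta001 VC x).1.
have hV beta : 0 < beta < 1 -> gamma * (1 + beta) < 1 ->
    locally_holder beta (grad (V t)).
  move=> beta01 gb; have [C' [C'0 VC']] := modulusV beta beta01 gb.
  exact: modulus_locally_holder VC'.
exists (grad (V t)); split=> // [x|beta beta01 gb].
  exists eps; split=> //; first exact: cvg_harmonic.
    move=> n; have uCn rho := uC (eps n) rho (eps0 n).
    exact: (modulus_differentiable _ _ _ beta001 uCn x).1.
  apply: (modulus_grad_weak_cvg beta0 C _ _ x beta001 _ cv) => n rho.
  exact: uC.
split=> //; last exact: hV.
have /andP[b0 _] := beta01.
exact: (locally_holder_continuous _ _ b0 (hV _ beta01 gb)).
Qed.
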